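(* Let $(Z,d,\nu)$ be a complete doubling metric measure space, $p\ge1$ and $0<\theta<1$. Each function in $\tilde B^\theta_p(Z)$ has a representative (a function agreeing with it $\nu$-a.e.) which is quasicontinuous with respect to the Besov capacity. This representative has $L^p(Z)$-Lebesgue points quasieverywhere with respect to the Besov capacity.
   Context: A metric measure space is a metric space with a Borel regular measure giving every ball positive finite measure; it is doubling if $\nu(B(z,2r))\le C_\nu\nu(B(z,r))$ for all $z,r$. $L^p_{\rm loc}(Z)$: measurable functions in $L^p(B)$ for every ball $B\subset Z$. $\|u\|_{B^\theta_p(Z)}^p=\int_Z\int_Z\frac{|u(x)-u(y)|^p}{d(x,y)^{p\theta}}\frac{d\nu(x)\,d\nu(y)}{\nu(B(x,d(x,y)))}$; $\tilde B^\theta_p(Z)=\{u\in L^p_{\rm loc}(Z):\|u\|_{B^\theta_p(Z)}<\infty\}$; $\check B^\theta_p(Z)=L^p(Z)\cap\tilde B^\theta_p(Z)$ with norm $\|u\|_{\check B^\theta_p(Z)}=\|u\|_{L^p(Z)}+\|u\|_{B^\theta_p(Z)}$. Besov capacity of $G\subset Z$: $C^Z_{\check B^\theta_p}(G)=\inf_u\|u\|^p_{\check B^\theta_p(Z)}$, the infimum over $u\in\check B^\theta_p(Z)$ with $u\ge1$ $\nu$-a.e. on a neighborhood of $G$. A property holds quasieverywhere with respect to the Besov capacity if it fails only on a set of zero Besov capacity. $u$ is quasicontinuous with respect to the Besov capacity if for each $\eta>0$ there is an open $U\subset Z$ with $C^Z_{\check B^\theta_p}(U)<\eta$ and $u|_{Z\setminus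 U}$ continuous. A point $x$ is an $L^p(Z)$-Lebesgue point of $u$ if $\lim_{r\to0^+}\frac1{\nu(B(x,r))}\int_{B(x,r)}|u-u(x)|^p\,d\nu=0$. *)

(* Defs.v *)
From HB Require Import structures.
From mathcomp Require Export all_boot all_order all_algebra.
From mathcomp Require Export all_classical all_reals all_analysis.
Export numFieldNormedType.Exports.

Set Implicit Arguments.
Unset Strict Implicit.
Unset Printing Implicit Defensive.

Import Order.TTheory GRing.Theory Num.Theory.

Local Open Scope classical_set_scope.
Local Open Scope ring_scope.
Local Open Scope ereal_scope.

#[short(type="completeMetricType")]
HB.structure Definition CompleteMetric (R : numDomainType) :=
  {T of Metric R T & Complete T}.

(* As is usual in analysis on metric spaces, the measure nu is an outer measure
   defined on all subsets of Z. "Measurable" means Caratheodory measurable, and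
   integrals are taken against the (complete) measure that nu induces on its
   Caratheodory sigma-algebra. *)
Notation cara_measure nu := (nu : set (caratheodory_type nu) -> \bar _).

Section besov.
Context {R : realType} {Z : completeMetricType R}.
Variable nu : {outer_measure set Z -> \bar R}.

Definition borel_regular : Prop :=
  (forall U : set Z, open U -> nu.-caratheodory U) /\
  (forall A : set Z, exists B, [/\ <<s @open Z >> B, A `<=` B & nu B = nu A]).

Definition metric_measure : Prop :=
  borel_regular /\
  (forall (z : Z) (r : R), (0 < r)%R -> 0 < nu (ball z r) < +oo).

Definition doubling : Prop :=
  exists C : R, forall (z : Z) (r : R), (0 < r)%R ->
    nu (ball z (2 * r)%R) <= C%:E * nu (ball z r).

Variables theta p : R.
Implicit Types (u v : Z -> R) (G U V : set Z) (P : Z -> Prop).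

Definition ae_eq_fun u v : Prop :=
  {ae cara_measure nu, forall x, u x = v x}.

Definition nu_measurable u : Prop :=
  measurable_fun [set: caratheodory_type nu] (u : caratheodory_type nu -> R).

Definition Lp_norm u : \bar R :=
  Lnorm (cara_measure nu) p%:E (EFin \o u).

Definition Lp u : Prop := nu_measurable u /\ Lp_norm u < +oo.

Definition Lp_loc u : Prop :=
  nu_measurable u /\
  (forall (z : Z) (r : R), (0 < r)%R ->
    \int[cara_measure nu]_(x in ball z r) (`|u x| `^ p)%:E < +oo).

(* On the diagonal x = y the numerator is 0 (when 0 < p) and [0 * +oo = 0] in
   [\bar R], so the integrand is 0 there; this matters only if nu has atoms. *)
Definition besov_norm u : \bar R :=
  (\int[cara_measure nu]_y \int[cara_measure nu]_x
     ((`|u x - u y| `^ p / mdist x y `^ (p * theta))%:E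
        * (nu (ball x (mdist x y)))^-1)) `^ p^-1.

Definition besov_tilde u : Prop := Lp_loc u /\ besov_norm u < +oo.

Definition besov_check u : Prop := Lp u /\ besov_tilde u.

Definition besov_check_norm u : \bar R := Lp_norm u + besov_norm u.

Definition besov_capacity G : \bar R :=
  ereal_inf [set besov_check_norm u `^ p | u in
    [set u | besov_check u /\
       exists2 V, G `<=` V° &
         {ae cara_measure nu, forall x, V x -> (1 <= u x)%R}]].

Definition quasieverywhere P : Prop := besov_capacity [set x | ~ P x] = 0.

Definition quasicontinuous v : Prop :=
  forall eta : R, (0 < eta)%R -> exists U,
    [/\ open U, besov_capacity U < eta%:E & {within ~` U, continuous v}].

Definition Lp_lebesgue_point v (x : Z) : Prop :=
  (nu (ball x r))^-1 *
    \int[cara_measure nu]_(y in ball x r) (`|v y - v x| `^ p)%:E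
  @[r --> (0 : R)^'+] --> (0 : \bar R).

End besov.

(* Main.v *)
From HB Require Import structures.
From mathcomp Require Import ring lra measurable_realfun.
Require Import Defs.

(* Let r_k = 2^-k, let u_k be the mean of u at scale r_k against a Lipschitz
   kernel, and let a_k(x) be the mean of |u - u(x)|^p over B(x, 2 r_k). Up to
   constants, the p-th power of the Besov seminorm dominates
   sum_k r_k^(-p theta) int a_k. Conversely, for a function f that varies at
   scale r_k, in the sense that |f x - f y|^p is at most
   min(1, d(x,y)/r_k)^p (b x + b y), that p-th power is at most a constant times
   r_k^(-p theta) int b. Each |u_k - u| is such a function with b = a_k, apart
   from a term |u x - u y| for d(x,y) < r_k, and so is a Lipschitz majorant W_k
   of the L^p oscillation of u around u_k on balls of radius r_k. Choose weights
   w_k increasing to infinity such that sum_k w_k r_k^(-p theta) int a_k is still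
   finite. The supremum over k >= K of the functions w_k^(1/p) (|u_k - u| + W_k),
   truncated at 1, has Besov norm tending to 0 as K grows, so it shows that the
   open set U_K where some W_k exceeds w_k^(-1/p) or some |u_k - u_l| exceeds
   2 w_k^(-1/p) has small capacity. Off U_K the continuous functions u_k converge
   uniformly and the oscillations tend to 0, which gives quasicontinuity and the
   Lebesgue points of the limit. *)

Set Implicit Arguments.
Unset Strict Implicit.
Unset Printing Implicit Defensive.

Import Order.TTheory GRing.Theory Num.Theory.

Local Open Scope classical_set_scope.
Local Open Scope ring_scope.

(** * Powers, series and integrals *)

(** The obstacle is the term |u x - u y| for d(x,y) < r_k: [u] itself need not vary slowly at any
    scale, so |u_k - u| is not Lipschitz at scale r_k. In a supremum over k this term occurs for one
    k at a time, and as the weights increase it can be charged to the scale m >= k with r_m / 2 <=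
    d(x,y) < r_m. On that shell the Besov weight is comparable to r_m^(-p theta) times the kernel of
    a ball of radius 2 r_m, so the term integrates to a_m. A sum over k instead of a supremum would
    count it for every k with r_k > d(x,y). The range 0 < theta < 1 enters through two geometric
    series: distances larger than r_k are summed with ratio 2^(-p theta), smaller ones with ratio
    2^(-p (1 - theta)). *)

Lemma powRD_le (R : realType) (a b p : R) : 0 <= a -> 0 <= b -> 0 <= p ->
  (a + b) `^ p <= 2 `^ p * (a `^ p + b `^ p).
Proof.
move=> a0 b0 p0.
wlog ab : a b a0 b0 / a <= b.
  move=> H; have [ab|/ltW ba] := leP a b; first exact: H.
  by rewrite addrC [X in _ * X]addrC; exact: H.
have : (a + b) `^ p <= (2 * b) `^ p.
  by apply: ge0_ler_powR; rewrite ?nnegrE//; lra.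
move/le_trans; apply; rewrite powRM// ler_wpM2l ?powR_ge0//.
by rewrite lerDr powR_ge0.
Qed.

Lemma inv_powR (R : realType) (a p : R) : 0 <= a -> (a^-1) `^ p = (a `^ p)^-1.
Proof. by move=> a0; rewrite -powR_inv1// powRAC powR_inv1// powR_ge0. Qed.

Lemma powR_invK (R : realType) (a p : R) : 0 <= a -> 0 < p ->
  (a `^ p^-1) `^ p = a.
Proof. by move=> a0 p0; rewrite -powRrM mulVf ?gt_eqF// powRr1. Qed.

Lemma powR_Kinv (R : realType) (a p : R) : 0 <= a -> 0 < p ->
  (a `^ p) `^ p^-1 = a.
Proof. by move=> a0 p0; rewrite -powRrM divff ?gt_eqF// powRr1. Qed.

Lemma ler_powR2r (R : realType) (a b p : R) : 0 <= p -> 0 <= a -> a <= b ->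
  a `^ p <= b `^ p.
Proof.
move=> p0 a0 ab; apply: ge0_ler_powR; rewrite ?nnegrE//.
exact: le_trans ab.
Qed.

Lemma le_powR_inv (R : realType) (a b p : R) : 0 < p -> 0 <= a -> 0 <= b ->
  a `^ p <= b -> a <= b `^ p^-1.
Proof.
move=> p0 a0 b0 ab; rewrite -[a](powR_Kinv a0 p0); apply: ler_powR2r => //.
  by rewrite invr_ge0 ltW.
exact: powR_ge0.
Qed.

Lemma powR_inv_le (R : realType) (a b p : R) : 0 < p -> 0 <= a -> 0 <= b ->
  a <= b `^ p^-1 -> a `^ p <= b.
Proof.
move=> p0 a0 b0 ab; rewrite -[b in _ <= b](powR_invK b0 p0); apply: ler_powR2r => //.
exact: ltW.
Qed.

Section series_integrals.
Local Open Scope ereal_scope.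

(* Unlike [ge0_le_integral], no measurability is needed: the integral of a
   nonnegative function is a supremum over the simple functions below it. *)
Lemma ge0_le_integralT d (T : measurableType d) (R : realType)
    (mu : {measure set T -> \bar R}) (f g : T -> \bar R) :
  (forall x, 0 <= f x) -> (forall x, f x <= g x) ->
  \int[mu]_x f x <= \int[mu]_x g x.
Proof.
move=> f0 fg; rewrite !ge0_integralTE//; last first.
  by move=> x; exact: le_trans (fg x).
apply: ge_ereal_sup => _ [h /= hf <-]; apply: ereal_sup_ubound; exists h => //=.
by move=> x; exact: le_trans (fg x).
Qed.

Lemma nneseries_le (R : realType) (u : nat -> \bar R) (M : \bar R) :
  (forall n, 0 <= u n) -> (forall n, \sum_(0 <= i < n) u i <= M) ->
  \sum_(i <oo) u i <= M.
Proof.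
move=> u0 uM; apply: lime_le; first by apply: is_cvg_nneseries.
by apply: nearW => n; exact: uM.
Qed.

Lemma nneseries_term_le (R : realType) (u : nat -> \bar R) (k : nat) :
  (forall n, 0 <= u n) -> u k <= \sum_(i <oo) u i.
Proof.
move=> u0; apply: le_trans (nneseries_lim_ge k.+1 _) => //.
by rewrite big_nat_recr//= leeDr// sume_ge0.
Qed.

Lemma nneseries_geometric_le (R : realType) (c : R) : (0 < c < 1)%R ->
  \sum_(i <oo) (c ^+ i)%:E <= ((1 - c)^-1)%:E.
Proof.
move=> /andP[c0 c1]; apply: nneseries_le => n.
  by rewrite lee_fin exprn_ge0// ltW.
rewrite sumEFin lee_fin.
have := @geometric_le_lim R n 1%R c ler01 c0.
rewrite ger0_norm ?(ltW c0)// => /(_ c1).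
by rewrite mul1r /series/= /geometric/=; under eq_bigr do rewrite mul1r.
Qed.

(* A convergent series stays convergent after multiplication by suitable weights
   tending to infinity: take the inverse square roots of its remainders. *)
Lemma summable_weights (R : realType) (e : nat -> \bar R) :
  (forall k, 0 <= e k) -> \sum_(k <oo) e k < +oo ->
  exists w : nat -> R, [/\ forall k, (0 < w k)%R,
    forall m n, (m <= n)%N -> (w m <= w n)%R,
    forall M : R, exists K, forall k, (K <= k)%N -> (M <= w k)%R &
    forall eps : R, (0 < eps)%R -> exists K,
      \sum_(k <oo) ((if (K <= k)%N then w k else 0)%:E * e k) <= eps%:E].
Proof.
move=> e0 efin.
have efink k : e k \is a fin_num.
  rewrite ge0_fin_numE//; apply: le_lt_trans efin; exact: nneseries_term_le.
(* The geometric term keeps all remainders positive even if [e] vanishes from some index on, so that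
   their inverse square roots exist. *)
pose E k : R := (fine (e k) + 2^-1 ^+ k)%R.
have E0 k : (0 < E k)%R.
  by rewrite ltr_wpDl// ?fine_ge0// exprn_gt0// invr_gt0.
have EE0 k : 0 <= (E k)%:E by rewrite lee_fin ltW.
have Efin : \sum_(k <oo) (E k)%:E < +oo.
  rewrite (_ : (fun n => _) = fun n => \sum_(0 <= k < n) (e k + (2^-1 ^+ k)%:E));
    last by apply/funext => n; apply: eq_bigr => k _; rewrite EFinD fineK.
  rewrite nneseriesD//.
  apply: lte_add_pinfty => //; apply: le_lt_trans (nneseries_geometric_le _) _.
    by apply/andP; split; lra.
  by rewrite ltry.
pose t k : R := fine (\sum_(k <= i <oo) (E i)%:E).
have tsplit k : \sum_(k <= i <oo) (E i)%:E =
    (E k)%:E + \sum_(k.+1 <= i <oo) (E i)%:E.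
  by rewrite (nneseries_split k 1)// addn1 big_nat1.
have tge0 k : 0 <= \sum_(k <= i <oo) (E i)%:E by apply: nneseries_ge0.
have tfin k : \sum_(k <= i <oo) (E i)%:E \is a fin_num.
  rewrite ge0_fin_numE//; apply: le_lt_trans Efin.
  rewrite (nneseries_split 0 k)// add0n leeDr//.
  by apply: sume_ge0.
have tE k : (\sum_(k <= i <oo) (E i)%:E) = (t k)%:E by rewrite fineK.
have tS k : (t k = E k + t k.+1)%R.
  by apply: EFin_inj; rewrite EFinD -!tE tsplit.
have t_ge0 k : (0 <= t k)%R by apply: fine_ge0.
have t0 k : (0 < t k)%R by rewrite tS ltr_pwDl.
have tdec m n : (m <= n)%N -> (t n <= t m)%R.
  elim: n => [|n IH]; first by rewrite leqn0 => /eqP ->.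
  rewrite leq_eqVlt => /predU1P[->//|]; rewrite ltnS => /IH.
  by apply: le_trans; rewrite (tS n) lerDr ltW.
have tcvg (eps : R) : (0 < eps)%R -> exists K, forall k, (K <= k)%N -> (t k <= eps)%R.
  move=> eps0; have := @nneseries_tail_cvg R (fun k => (E k)%:E) xpredT Efin.
  move=> /(_ (fun k _ => EE0 k)).
  rewrite [X in X @ _](_ : _ = EFin \o t); last by apply/funext => k /=; exact: tE.
  move/fine_cvgP => [_] /cvgrPdist_lt /(_ _ eps0)[K _ HK]; exists K => k Kk.
  have := HK k Kk; rewrite sub0r normrN/= ger0_norm//.
  exact: ltW.
pose s k := Num.sqrt (t k).
have s0 k : (0 < s k)%R by rewrite sqrtr_gt0.
have sdec m n : (m <= n)%N -> (s n <= s m)%R by move=> mn; apply: ler_wsqrtr; exact: tdec.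
have s2 k : (s k * s k = t k)%R by rewrite -expr2 sqr_sqrtr.
exists (fun k => (s k)^-1)%R; split.
- by move=> k; rewrite invr_gt0.
- by move=> m n mn; rewrite lef_pV2 ?posrE//; exact: sdec.
- move=> M; have m0 : (0 < Num.max M 1)%R by rewrite lt_max ltr01 orbT.
  have [|K HK] := tcvg ((Num.max M 1)^-1 ^+ 2)%R.
    by rewrite exprn_gt0// invr_gt0.
  exists K => k Kk.
  apply: (@le_trans _ _ (Num.max M 1)%R); first by rewrite le_max lexx.
  rewrite -[X in (X <= _)%R]invrK lef_pV2 ?posrE ?invr_gt0//.
  rewrite -(@ler_pXn2r _ 2)// ?nnegrE ?(ltW (s0 _)) ?invr_ge0 ?(ltW m0)//.
  by rewrite expr2 s2 HK.
- move=> eps eps0.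
  have [|K HK] := tcvg ((eps / 2) ^+ 2)%R; first by rewrite exprn_gt0// divr_gt0.
  exists K; apply: nneseries_le => n.
    rewrite mule_ge0// lee_fin; case: ifP => // _.
    by rewrite invr_ge0 ltW.
  (* Telescoping: [E k] is the product of [s k - s k.+1] and [s k + s k.+1], and dividing by [s k]
     leaves at most [2 * (s k - s k.+1)]. The [maxn] covers the partial sums that stop before [K],
     which vanish. *)
  apply: (@le_trans _ _ (2 * (s K - s (maxn n K)))%:E); last first.
    rewrite lee_fin; apply: (@le_trans _ _ (2 * s K)%R).
      by rewrite ler_pM2l// gerBl ltW.
    have : (s K <= eps / 2)%R; last by lra.
    rewrite -(@ler_pXn2r _ 2)// ?nnegrE ?(ltW (s0 _))//; last by lra.
    by rewrite expr2 s2 HK.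
  elim: n => [|n IH].
    by rewrite big_nil max0n subrr mulr0.
  rewrite big_nat_recr//=; case: leqP => [Kn|nK].
    rewrite (maxn_idPl (leqW Kn)).
    rewrite (maxn_idPl Kn) in IH.
    apply: le_trans (leeD IH (lexx _)) _.
    rewrite -(fineK (efink n)) -EFinM -EFinD lee_fin.
    have : ((s n)^-1 * fine (e n) <= 2 * (s n - s n.+1))%R; last by lra.
    rewrite mulrC ler_pdivrMr//.
    have : (fine (e n) <= E n)%R by rewrite lerDl exprn_ge0// invr_ge0.
    have -> : E n = (s n * s n - s n.+1 * s n.+1)%R by rewrite !s2 tS addrK.
    move/le_trans; apply.
    have := sdec n n.+1 (leqnSn n); have := s0 n.+1; have := s0 n.
    by nra.
  rewrite mul0e adde0; apply: le_trans IH _.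
  by rewrite (maxn_idPr nK) (maxn_idPr (ltnW nK)).
Qed.

End series_integrals.

(** * Doubling spaces *)

Definition mball (R : realType) T (dist : T -> T -> R) (x : T) (r : R) : set T :=
  [set y | dist x y < r].

(** The distance is a bare function on a measurable type because the two structures have different
    sources: the sigma-algebra is the Caratheodory one of [nu], the distance that of [Z]. The
    measurability of open sets links them. *)
Record doubling_space d (T : measurableType d) (R : realType)
    (mu : {sigma_finite_measure set T -> \bar R}) (dist : T -> T -> R) (A : R)
    : Prop := DoublingSpace {
  dist_xx : forall x, dist x x = 0;
  dist_eq0 : forall x y, dist x y = 0 -> x = y;
  dist_sym : forall x y, dist x y = dist y x;
  dist_triangle : forall y x z, dist x z <= dist x y + dist y z;
  open_measurable_dist : forall U : set T,
    (forall x, U x -> exists2 e, 0 < e & mball dist x e `<=` U) -> measurable U;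
  mball_fin : forall x r, 0 < r -> (0 < mu (mball dist x r) < +oo)%E;
  mball_doubling : forall x r, 0 < r ->
    (mu (mball dist x (2 * r)) <= A%:E * mu (mball dist x r))%E }.

Definition vol d (T : measurableType d) (R : realType)
    (mu : {sigma_finite_measure set T -> \bar R}) (dist : T -> T -> R) x r : R :=
  fine (mu (mball dist x r)).

Section doubling.
Context d (T : measurableType d) (R : realType)
  (mu : {sigma_finite_measure set T -> \bar R}) (dist : T -> T -> R) (A : R).
Hypothesis H : doubling_space mu dist A.

Local Notation B := (mball dist).
Local Notation vol := (vol mu dist).

Lemma dist_ge0 x y : 0 <= dist x y.
Proof.
have := dist_triangle H y x x; rewrite (dist_xx H) (dist_sym H y x).
by rewrite -mulr2n pmulrn_lge0.
Qed.

Lemma measurable_mball x r : measurable (B x r).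
Proof.
apply: (open_measurable_dist H) => y xy; exists (r - dist x y).
  by rewrite subr_gt0.
by move=> z; rewrite /mball/= => yz; have := dist_triangle H y x z; lra.
Qed.

Lemma mu_mball x r : 0 < r -> mu (B x r) = (vol x r)%:E.
Proof.
by move=> r0; rewrite fineK// ge0_fin_numE//; case/andP: (mball_fin H x r0).
Qed.

Lemma vol_gt0 x r : 0 < r -> 0 < vol x r.
Proof.
by move=> r0; rewrite -lte_fin -mu_mball//; case/andP: (mball_fin H x r0).
Qed.

Lemma mball_sub x y s t : dist x y + s <= t -> B y s `<=` B x t.
Proof.
by move=> h z; rewrite /mball/=; have := dist_triangle H y x z; lra.
Qed.

Lemma vol_le x y s t : 0 < s -> dist x y + s <= t -> vol y s <= vol x t.
Proof.
move=> s0 h; have xy0 := dist_ge0 x y.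
rewrite -lee_fin -!mu_mball//; last by lra.
by apply: le_measure; rewrite ?inE; [exact: measurable_mball..|exact: mball_sub].
Qed.

Lemma vol_doubling x r : 0 < r -> vol x (2 * r) <= A * vol x r.
Proof.
move=> r0; rewrite -lee_fin EFinM -!mu_mball//; last by lra.
exact: mball_doubling.
Qed.

Lemma doubling_ge1 : 1 <= A.
Proof.
have x : T by exact: point.
have := vol_doubling x ltr01; rewrite mulr1.
have : vol x 1 <= vol x 2 by apply: vol_le => //; rewrite (dist_xx H); lra.
have := vol_gt0 x ltr01; nra.
Qed.

Let A0 : 0 < A. Proof. by have := doubling_ge1; lra. Qed.

(** Each doubling of a radius costs a factor [A]; the powers of [A] in later constants count such
    doublings. *)
Lemma vol_le_exp n x y s t : 0 < s -> 0 < t -> dist x y + s <= 2 ^+ n * t ->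
  vol y s <= A ^+ n * vol x t.
Proof.
move=> s0 t0 h; apply: le_trans (vol_le s0 h) _.
elim: n {h} => [|n IH]; first by rewrite !mul1r.
rewrite !exprS -!mulrA; apply: (le_trans (vol_doubling _ _)).
  by rewrite mulr_gt0// exprn_gt0.
by rewrite ler_pM2l.
Qed.

Lemma volV_le_exp n x y s t : 0 < s -> 0 < t -> dist x y + s <= 2 ^+ n * t ->
  (vol x t)^-1 <= A ^+ n * (vol y s)^-1.
Proof.
move=> s0 t0 h; have := vol_le_exp s0 t0 h => h1.
rewrite ler_pdivlMr ?vol_gt0// mulrC ler_pdivrMr ?vol_gt0//.
Qed.

(** A packing argument: without a finite net the ball contains [e]-separated families of any size.
    The balls of radius [e / 2] around their points are disjoint, lie in B(z, r + e), and each has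
    volume at least a fixed [c]. *)
Lemma finite_net z (r e : R) : 0 < r -> 0 < e ->
  exists s : seq T, forall x, dist z x < r -> exists2 y, y \in s & dist y x < e.
Proof.
move=> r0 e0; apply: contrapT => /forallNP nos.
have step (s : seq T) : exists x, dist z x < r /\ forall y, y \in s -> e <= dist y x.
  have /existsNP[x] := nos s; rewrite not_implyE => -[zx Hx]; exists x; split=> //.
  by move=> y ys; rewrite leNgt; apply/negP => yx; apply: Hx; exists y.
(* After [N] doublings, B(x, e / 2) covers B(z, r + e) for every [x] in B(z, r); this gives the
   common lower bound [c]. *)
have [N HN] : exists N, 2 * r + e <= 2 ^+ N * (e / 2).
  exists (Num.bound ((2 * r + e) / (e / 2))).
  rewrite -ler_pdivrMr ?divr_gt0//.
  have h0 : 0 <= (2 * r + e) / (e / 2) by rewrite divr_ge0//; lra.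
  have := archi_boundP h0 => /ltW /le_trans; apply.
  by rewrite -natrX ler_nat ltnW// ltn_expl.
pose c := vol z (r + e) / A ^+ N.
have c0 : 0 < c by rewrite divr_gt0 ?exprn_gt0// vol_gt0//; lra.
pose U (s : seq T) := [set x | exists2 y, y \in s & dist y x < e / 2].
have mU s : measurable (U s).
  apply: (open_measurable_dist H) => x [y ys yx]; exists (e / 2 - dist y x).
    by rewrite subr_gt0.
  move=> w xw; exists y => //.
  by move: xw; rewrite /mball/=; have := dist_triangle H x y w; lra.
have sep n : exists s, [/\ size s = n, (forall y, y \in s -> dist z y < r) &
    ((n%:R * c)%:E <= mu (U s))%E].
  elim: n => [|n [s [sn sz sU]]].
    by exists [::]; split => //; rewrite mul0r.
  have [x [zx xs]] := step s; exists (x :: s); split.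
  - by rewrite /= sn.
  - by move=> y; rewrite inE => /predU1P[->//|]; exact: sz.
  have -> : U (x :: s) = B x (e / 2) `|` U s.
    apply/seteqP; split => w.
      by move=> [y]; rewrite inE => /predU1P[->|ys] yw; [left|right; exists y].
    move=> [xw|[y ys yw]]; first by exists x; rewrite ?inE ?eqxx.
    by exists y; rewrite ?inE ?ys ?orbT.
  rewrite measureU//; last 2 first.
  - exact: measurable_mball.
  - apply/seteqP; split => // w [/= xw [y ys yw]].
    have := xs y ys; have := dist_triangle H w y x; rewrite (dist_sym H w x).
    by move: xw; rewrite /mball/=; lra.
  rewrite -natr1 mulrDl mul1r EFinD [leRHS]addeC; apply: leeD => //.
  rewrite [leRHS]mu_mball ?divr_gt0// lee_fin /c ler_pdivrMr ?exprn_gt0// mulrC.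
  apply: vol_le_exp; rewrite ?divr_gt0//; first by lra.
  by rewrite (dist_sym H); lra.
pose n := (Num.bound (vol z (r + e) / c)).
have [s [_ sz sU]] := sep n.
have : (mu (U s) <= (vol z (r + e))%:E)%E.
  rewrite -mu_mball; last by lra.
  apply: le_measure; rewrite ?inE//; first exact: measurable_mball.
  move=> x [y ys yx]; rewrite /mball/=.
  by have := sz y ys; have := dist_triangle H y z x; lra.
move/(le_trans sU); rewrite lee_fin leNgt => /negP; apply.
rewrite -ltr_pdivrMr//; apply: archi_boundP.
by rewrite divr_ge0 ?(ltW c0)// ltW// vol_gt0//; lra.
Qed.

(** Nets of mesh 1 / (m + 1) in the balls of radius n + 1 around [point] are listed along the
    pickling of (n, m) and of the position in the net; indices that decode to nothing give
    [point]. *)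
Lemma dense_sequence :
  exists D : nat -> T, forall x e, 0 < e -> exists n, dist (D n) x < e.
Proof.
have net (nm : nat * nat) : exists s : seq T, forall x,
    dist point x < nm.1.+1%:R -> exists2 y, y \in s & dist y x < nm.2.+1%:R^-1.
  by apply: finite_net; rewrite ?invr_gt0.
have [s Hs] := choice net.
exists (fun k => if unpickle k is Some (nm, j) then nth point (s nm) j else point).
move=> x e e0.
pose n := Num.bound (dist point x).
have xn : dist point x < n.+1%:R.
  apply: lt_trans (archi_boundP (dist_ge0 _ _)) _.
  by rewrite ltr_nat.
have [m mE] : exists m, m.+1%:R^-1 < e.
  exists (Num.bound e^-1); rewrite -[ltRHS]invrK ltf_pV2 ?posrE ?invr_gt0//.
  apply: lt_trans (archi_boundP _) _; last by rewrite ltr_nat.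
  by rewrite invr_ge0 ltW.
have [y ys yx] := Hs (n, m) x xn.
exists (pickle ((n, m), index y (s (n, m)))); rewrite pickleK nth_index//.
exact: lt_trans mE.
Qed.

(** Separability lets countably many rectangles exhaust a sublevel set: they are the products of B(D
    n, e) and B(D n, s - e) with e = 1 / (m + 1). *)
Lemma measurable_dist : measurable_fun setT (fun z : T * T => dist z.1 z.2).
Proof.
have [D HD] := dense_sequence.
apply: (measurability _ (RGenInftyO.measurableE R)) => _ [_ [s ->] <-].
rewrite setTI [X in measurable X](_ : _ =
    \bigcup_m \bigcup_n (B (D n) m.+1%:R^-1 `*` B (D n) (s - m.+1%:R^-1))).
  apply: bigcup_measurable => m _; apply: bigcup_measurable => n _.
  by apply: measurableX; exact: measurable_mball.
apply/seteqP; split => -[x y] /=.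
  rewrite in_itv/= => xys.
  have [m mE] : exists m, m.+1%:R^-1 < (s - dist x y) / 2.
    exists (Num.bound ((s - dist x y) / 2)^-1).
    rewrite -[ltRHS]invrK ltf_pV2 ?posrE ?invr_gt0//; last by lra.
    apply: lt_trans (archi_boundP _) _; last by rewrite ltr_nat.
    by rewrite invr_ge0; lra.
  have m0 : 0 < m.+1%:R^-1 :> R by rewrite invr_gt0.
  have [n nx] := HD x _ m0.
  exists m => //; exists n => //; rewrite /mball/=; split => //=.
  have := dist_triangle H x (D n) y; move: nx mE => {m0}.
  by move: (m.+1%:R^-1) => e; lra.
move=> [m _ [n _ []]]; rewrite /mball/= in_itv/= => xm my.
have := dist_triangle H (D n) x y; rewrite (dist_sym H x (D n)).
by move: (m.+1%:R^-1) xm my => e; lra.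
Qed.

End doubling.

(** * Means over balls *)

(** Ball means are written with a kernel on all pairs so that Tonelli applies and means over
    different balls compare pointwise. The normalisation uses the ball around the first variable, so
    symmetry holds only up to the factor [A]. *)
Definition ball_kernel d (T : measurableType d) (R : realType)
    (mu : {sigma_finite_measure set T -> \bar R}) (dist : T -> T -> R) s x y : R :=
  if dist x y < s then (vol mu dist x s)^-1 else 0.

Definition mean d (T : measurableType d) (R : realType)
    (mu : {sigma_finite_measure set T -> \bar R}) (dist : T -> T -> R) s
    (f : T -> \bar R) x : \bar R :=
  (\int[mu]_y ((ball_kernel mu dist s x y)%:E * f y))%E.

(* Instead of Hölder: integrate [f <= s + s^(1-p) f^p] for [s > t], where the
   right-hand side has mean at most [2 s], and let [s] decrease to [t]. *)
Lemma weighted_mean_powR_le d (T : measurableType d) (R : realType)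
    (mu : {measure set T -> \bar R}) (w f : T -> R) (p t : R) :
  1 <= p -> 0 <= t -> (forall x, 0 <= w x) -> (forall x, 0 <= f x) ->
  measurable_fun setT w -> measurable_fun setT f ->
  (\int[mu]_x (w x)%:E <= 1)%E ->
  (\int[mu]_x (w x * f x `^ p)%:E <= (t `^ p)%:E)%E ->
  (\int[mu]_x (w x * f x)%:E <= (2 * t)%:E)%E.
Proof.
move=> p1 t0 w0 f0 mw mf w1 wf.
have p0 : 0 < p by lra.
have mfp : measurable_fun setT (fun x => f x `^ p).
  exact: (measurableT_comp (measurable_powR p)).
suff H s : t < s -> (\int[mu]_x (w x * f x)%:E <= (2 * s)%:E)%E.
  apply/lee_addgt0Pr => e e0.
  have -> : ((2 * t)%:E + e%:E = (2 * (t + e / 2))%:E)%E.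
    by rewrite -EFinD; congr EFin; lra.
  by apply: H; lra.
move=> ts; have s0 : 0 < s by lra.
have pw : forall x, w x * f x <= s * w x + s `^ (1 - p) * (w x * f x `^ p).
  move=> x; rewrite [s * _]mulrC mulrCA -mulrDr ler_wpM2l//.
  have [fs|sf] := leP (f x) s.
    by apply: (le_trans fs); rewrite lerDl mulr_ge0// powR_ge0.
  have fx0 : 0 < f x by lra.
  have : 1 <= (f x / s) `^ (p - 1).
    rewrite -[leLHS](powRr0 (f x / s)); apply: ler_powR; last by lra.
    by rewrite ler_pdivlMr// mul1r ltW.
  move=> h; have : f x <= f x * (f x / s) `^ (p - 1) by rewrite ler_peMr// ltW.
  suff -> : f x * (f x / s) `^ (p - 1) = s `^ (1 - p) * f x `^ p by lra.
  rewrite powRM ?invr_ge0 ?(ltW s0) ?(ltW fx0)// mulrA mulr_powRB1 ?(ltW fx0)//.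
  by rewrite mulrC -powR_inv1 ?(ltW s0)// -powRrM mulN1r opprB.
have h1 : (\int[mu]_x (w x * f x)%:E <=
    \int[mu]_x (s%:E * (w x)%:E + (s `^ (1 - p))%:E * (w x * f x `^ p)%:E))%E.
  apply: ge0_le_integralT => x; first by rewrite lee_fin mulr_ge0.
  by rewrite -!EFinM -EFinD lee_fin pw.
apply: (le_trans h1).
have mw' : measurable_fun setT (EFin \o w) by exact/measurable_EFinP.
have mwf' : measurable_fun setT (fun x => (w x * f x `^ p)%:E).
  by apply/measurable_EFinP; apply: measurable_funM.
rewrite ge0_integralD//; last 4 first.
- by move=> x _; rewrite mule_ge0// lee_fin// ltW.
- by apply: measurable_funeM.
- by move=> x _; rewrite mule_ge0// lee_fin ?powR_ge0// mulr_ge0// powR_ge0.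
- by apply: measurable_funeM.
rewrite !ge0_integralZl//; last 4 first.
- by move=> x _; rewrite lee_fin mulr_ge0// powR_ge0.
- by rewrite lee_fin powR_ge0.
- by move=> x _; rewrite lee_fin.
- by rewrite lee_fin ltW.
apply: (@le_trans _ _ (s%:E * 1 + (s `^ (1 - p))%:E * (t `^ p)%:E)%E).
  apply: leeD; first by rewrite lee_pmul2l.
  by rewrite lee_wpmul2l// lee_fin powR_ge0.
rewrite mule1 -EFinM -EFinD lee_fin.
have : s `^ (1 - p) * t `^ p <= s `^ (1 - p) * s `^ p.
  by rewrite ler_wpM2l ?powR_ge0//; apply: ler_powR2r; lra.
rewrite -powRD ?(gt_eqF s0) ?implybT// subrK powRr1; last by lra.
by lra.
Qed.

Section kernels.
Context d (T : measurableType d) (R : realType)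
  (mu : {sigma_finite_measure set T -> \bar R}) (dist : T -> T -> R) (A : R).
Hypothesis H : doubling_space mu dist A.

Local Notation B := (mball dist).
Local Notation vol := (vol mu dist).
Local Notation ker := (ball_kernel mu dist).
Local Notation mean := (mean mu dist).

Lemma ker_ge0 s x y : 0 <= ker s x y.
Proof. by rewrite /ball_kernel; case: ifP => // _; rewrite invr_ge0 fine_ge0. Qed.

Lemma measurable_vol s : measurable_fun setT (vol ^~ s).
Proof.
apply: (measurableT_comp (@fine_measurable R setT measurableT)).
have mD : measurable [set z : T * T | dist z.1 z.2 < s].
  have := measurable_dist H measurableT (measurable_itv `]-oo, s[).
  by rewrite setTI; congr (measurable _); apply/seteqP; split => z /=; rewrite in_itv.
have := measurable_fun_xsection mu mD.
by congr measurable_fun; apply/funext => x /=; congr (mu _); apply/seteqP; split => y;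
  rewrite /xsection/= ?inE//= ?mem_set.
Qed.

Lemma measurable_ker s : measurable_fun setT (fun z : T * T => ker s z.1 z.2).
Proof.
apply: measurable_fun_ifT.
- apply: measurable_fun_ltr; first exact: measurable_dist H.
  exact: measurable_cst.
- have mV : measurable_fun setT (fun x => (vol x s)^-1).
    rewrite (_ : (fun x => _) = (fun x => (vol x s) `^ (-1))).
      by apply: (measurableT_comp (measurable_powR _)); exact: measurable_vol.
    by apply/funext => x; rewrite powR_inv1// fine_ge0.
  exact: (measurableT_comp mV measurable_fst).
- exact: measurable_cst.
Qed.

Lemma measurable_ker_r s x : measurable_fun setT (ker s x).
Proof. exact: (measurable_fun_pair2 _ (measurable_ker s)). Qed.

Lemma measurable_ker_l s y : measurable_fun setT (ker s ^~ y).
Proof. exact: (measurable_fun_pair1 _ (measurable_ker s)). Qed.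

Lemma int_kerr s x : 0 < s -> (\int[mu]_y (ker s x y)%:E = 1)%E.
Proof.
move=> s0; rewrite (_ : (fun y => _) = (fun y => ((vol x s)^-1)%:E * (\1_(B x s) y)%:E)%E).
  rewrite ge0_integralZl//; last 2 first.
  - by apply/measurable_EFinP; apply: measurable_indic; exact: measurable_mball H _ _.
  - by rewrite lee_fin invr_ge0 fine_ge0.
  rewrite integral_indic//; last exact: measurable_mball H _ _.
  rewrite setIT [X in (_ * X)%E](mu_mball H)// -EFinM mulVf// gt_eqF//; exact: vol_gt0 H _ _ _.
apply/funext => y; rewrite -EFinM /ball_kernel indicE; congr EFin.
case: ifPn => h; last by rewrite memNset ?mulr0//; exact/negP.
by rewrite mem_set ?mulr1.
Qed.

Lemma ker_le_exp n s t x y x' y' : 0 < s -> 0 < t ->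
  (dist x y < s -> dist x' y' < t) ->
  (dist x y < s -> dist x x' + t <= 2 ^+ n * s) ->
  ker s x y <= A ^+ n * ker t x' y'.
Proof.
move=> s0 t0 h1 h2; rewrite {1}/ball_kernel; case: ifPn => [xy|_].
  by rewrite /ball_kernel h1//; apply: (volV_le_exp H) => //; exact: h2.
rewrite mulr_ge0// ?ker_ge0// exprn_ge0//.
by have := doubling_ge1 H; lra.
Qed.

Lemma ker_sym_le s x y : 0 < s -> ker s x y <= A * ker s y x.
Proof.
move=> s0; rewrite -[A]expr1; apply: ker_le_exp => // xy; last by lra.
by rewrite (dist_sym H).
Qed.

Let A1 : 1 <= A. Proof. exact: doubling_ge1 H. Qed.
Let A0 : 0 <= A. Proof. exact: le_trans ler01 A1. Qed.

Lemma int_kerl s y : 0 < s -> (\int[mu]_x (ker s x y)%:E <= A%:E)%E.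
Proof.
move=> s0; apply: (@le_trans _ _ (\int[mu]_x (A%:E * (ker s y x)%:E))%E).
  apply: ge0_le_integralT => x; first by rewrite lee_fin ker_ge0.
  by rewrite -EFinM lee_fin ker_sym_le.
rewrite ge0_integralZl//; last 2 first.
- by apply/measurable_EFinP; exact: measurable_ker_r.
- by move=> x _; rewrite lee_fin ker_ge0.
by rewrite int_kerr// mule1.
Qed.

Lemma mean_ge0 s f x : (forall y, 0 <= f y)%E -> (0 <= mean s f x)%E.
Proof. by move=> f0; apply: integral_ge0 => y _; rewrite mule_ge0// lee_fin ker_ge0. Qed.

Lemma measurable_fst_comp d' (U : measurableType d') (f : T -> U) :
  measurable_fun setT f -> measurable_fun setT (fun z : T * T => f z.1).
Proof. by move=> mf; exact: (measurableT_comp mf measurable_fst). Qed.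

Lemma measurable_snd_comp d' (U : measurableType d') (f : T -> U) :
  measurable_fun setT f -> measurable_fun setT (fun z : T * T => f z.2).
Proof. by move=> mf; exact: (measurableT_comp mf measurable_snd). Qed.

Lemma measurable_ker_mul s (f : T * T -> \bar R) : measurable_fun setT f ->
  measurable_fun setT (fun z : T * T => (ker s z.1 z.2)%:E * f z)%E.
Proof.
move=> mf; apply: emeasurable_funM => //.
by apply/measurable_EFinP; exact: measurable_ker.
Qed.

Lemma measurable_mean s f : measurable_fun setT f -> (forall y, 0 <= f y)%E ->
  measurable_fun setT (mean s f).
Proof.
move=> mf f0.
apply: (measurable_fun_fubini_tonelli_F
  (fun z : T * T => (ker s z.1 z.2)%:E * f z.2)%E).
  by apply: measurable_ker_mul; exact: measurable_snd_comp.
by move=> z; rewrite mule_ge0// lee_fin ker_ge0.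
Qed.

(** Ball means are bounded on L^1 by Tonelli, since the kernel integrated over its centre is at most
    [A]. *)
Lemma int_mean_le s f : 0 < s -> measurable_fun setT f -> (forall y, 0 <= f y)%E ->
  (\int[mu]_x mean s f x <= A%:E * \int[mu]_y f y)%E.
Proof.
move=> s0 mf f0.
rewrite (fubini_tonelli (fun z : T * T => (ker s z.1 z.2)%:E * f z.2)%E)/=; last 2 first.
- by apply: measurable_ker_mul; exact: measurable_snd_comp.
- by move=> z; rewrite mule_ge0// lee_fin ker_ge0.
rewrite -ge0_integralZl//.
apply: ge0_le_integralT => y.
  by apply: integral_ge0 => x _; rewrite mule_ge0// lee_fin ker_ge0.
rewrite ge0_integralZr//; last 2 first.
- by apply/measurable_EFinP; exact: measurable_ker_l.
- by move=> x _; rewrite lee_fin ker_ge0.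
by rewrite lee_wpmul2r// int_kerl.
Qed.

Lemma int_ker_mul_le s (b : T -> \bar R) : 0 < s -> measurable_fun setT b ->
  (forall y, 0 <= b y)%E ->
  (\int[mu \x mu]_z ((ker s z.1 z.2)%:E * (b z.1 + b z.2)) <=
    (1 + A)%:E * \int[mu]_y b y)%E.
Proof.
move=> s0 mb b0.
have m1 := measurable_ker_mul s (measurable_fst_comp mb).
have m2 := measurable_ker_mul s (measurable_snd_comp mb).
have k0 x y : (0 <= (ker s x y)%:E)%E by rewrite lee_fin ker_ge0.
under eq_integral do rewrite ge0_muleDr//.
rewrite ge0_integralD//; last 2 first.
- by move=> z _; rewrite mule_ge0.
- by move=> z _; rewrite mule_ge0.
rewrite fubini_tonelli1//; last by move=> z; rewrite mule_ge0.
rewrite fubini_tonelli1//; last by move=> z; rewrite mule_ge0.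
rewrite EFinD ge0_muleDl//.
apply: leeD; last first.
  have h := int_mean_le s0 mb b0.
  exact: h.
rewrite mul1e; apply: ge0_le_integralT => x.
  by apply: integral_ge0 => y _; rewrite mule_ge0.
rewrite /fubini_F/= ge0_integralZr//; first by rewrite int_kerr// mul1e.
by apply/measurable_EFinP; exact: measurable_ker_r.
Qed.

End kernels.

(** * Besov energy *)

Lemma dyadic_le (R : realType) (t : R) : 1 <= t ->
  exists j, 2 ^+ j <= t < 2 ^+ j.+1.
Proof.
move=> t1; have ex : exists j, t < 2 ^+ j.
  exists (Num.bound t); apply: lt_trans (archi_boundP _) _; first by lra.
  by rewrite -natrX ltr_nat ltn_expl.
case: (ex_minnP ex) => -[|j] tj jmin; first by rewrite expr0 in tj; lra.
exists j; rewrite tj andbT leNgt; apply/negP => /jmin.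
by rewrite ltnn.
Qed.

(** The variant closed at the other end: applied to an inverse distance, it gives the strict upper
    bound on the distance that membership in a ball requires. *)
Lemma dyadic_lt (R : realType) (t : R) : 1 < t ->
  exists j, 2 ^+ j < t <= 2 ^+ j.+1.
Proof.
move=> t1; have ex : exists j, t <= 2 ^+ j.
  exists (Num.bound t); apply: le_trans (ltW (archi_boundP _)) _; first by lra.
  by rewrite -natrX ler_nat ltnW// ltn_expl.
case: (ex_minnP ex) => -[|j] tj jmin; first by rewrite expr0 in tj; lra.
exists j; rewrite tj andbT ltNge; apply/negP => /jmin.
by rewrite ltnn.
Qed.

Lemma powR_exprn (R : realType) (a q : R) j : 0 <= a ->
  (a ^+ j) `^ q = (a `^ q) ^+ j.
Proof. by move=> a0; rewrite -(powR_mulrn j a0) powRAC powR_mulrn// powR_ge0. Qed.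

Lemma pow2N_exprn (R : realType) (q : R) j :
  (2 `^ (- q)) ^+ j = ((2 ^+ j) `^ q)^-1.
Proof. by rewrite powRN exprVn powR_exprn. Qed.

(** For q = p theta this is the p-th power of [besov_norm]; the root is postponed to the end because
    p-th powers add up over the scales. *)
Definition energy d (T : measurableType d) (R : realType)
    (mu : {sigma_finite_measure set T -> \bar R}) (dist : T -> T -> R) (p q : R)
    (F : T -> R) : \bar R :=
  (\int[mu]_y \int[mu]_x
     ((`|F x - F y| `^ p / dist x y `^ q)%:E * (mu (mball dist x (dist x y)))^-1))%E.

Definition osc d (T : measurableType d) (R : realType)
    (mu : {sigma_finite_measure set T -> \bar R}) (dist : T -> T -> R) (p : R)
    (u : T -> R) s x : \bar R :=
  mean mu dist s (fun y => (`|u y - u x| `^ p)%:E) x.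

Definition besov_kernel d (T : measurableType d) (R : realType)
    (mu : {sigma_finite_measure set T -> \bar R}) (dist : T -> T -> R) (q : R)
    x y : R := (dist x y `^ q)^-1 * (vol mu dist x (dist x y))^-1.

(** The larger of the decay rates per dyadic step for distances above a given scale, 2^(-q), and
    below it, 2^(-(p - q)). It is less than 1 exactly when 0 < q < p. *)
Definition scale_ratio (R : realType) (p q : R) : R :=
  Num.max (2 `^ (- q)) (2 `^ (- (p - q))).

Definition radius (R : realType) (k : nat) : R := 2^-1 ^+ k.

(** All dyadic radii around [r] at once: the index j stands for the larger radius 2^(j+1) r and the
    smaller one r / 2^j. Summing over j avoids choosing, measurably in the pair of points, the one
    index that [kappa_le] provides. *)
Definition scale_kernel d (T : measurableType d) (R : realType)
    (mu : {sigma_finite_measure set T -> \bar R}) (dist : T -> T -> R)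
    (p q r : R) (b : T -> \bar R) (z : T * T) : \bar R :=
  (\sum_(j <oo) (scale_ratio p q ^+ j)%:E *
    ((ball_kernel mu dist (2 ^+ j.+1 * r) z.1 z.2)%:E * (b z.1 + b z.2) +
     (ball_kernel mu dist (r / 2 ^+ j) z.1 z.2)%:E * (b z.1 + b z.2)))%E.

(** The kernel is centred at the second variable because [energy] integrates over that variable
    last; the inner integral is then [osc] at [z.2]. *)
Definition osc_integrand d (T : measurableType d) (R : realType)
    (mu : {sigma_finite_measure set T -> \bar R}) (dist : T -> T -> R) (p : R)
    (u : T -> R) r (z : T * T) : \bar R :=
  ((ball_kernel mu dist r z.2 z.1)%:E * (`|u z.1 - u z.2| `^ p)%:E)%E.

(** * Upper bounds for the energy *)

Section energy_upper_bound.
Context d (T : measurableType d) (R : realType)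
  (mu : {sigma_finite_measure set T -> \bar R}) (dist : T -> T -> R) (A : R).
Hypothesis H : doubling_space mu dist A.
Variables p q : R.
Hypotheses (q0 : 0 < q) (qp : q < p).

Local Notation B := (mball dist).
Local Notation vol := (vol mu dist).
Local Notation ker := (ball_kernel mu dist).
Local Notation mean := (mean mu dist).
Local Notation energy := (energy mu dist p q).
Local Notation osc := (osc mu dist p).
Local Notation OSC := (osc_integrand mu dist p).

Let A1 : 1 <= A. Proof. exact: doubling_ge1 H. Qed.
Let A0 : 0 <= A. Proof. exact: le_trans ler01 A1. Qed.
Let A0' : 0 < A. Proof. exact: lt_le_trans ltr01 A1. Qed.

Let p0 : 0 < p. Proof. exact: lt_trans qp. Qed.

Local Notation c := (scale_ratio p q).
Local Notation kappa := (besov_kernel mu dist q).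
Local Notation rad := (radius R).
Local Notation scale := (scale_kernel mu dist p q).

Lemma scale_ratio01 : 0 < c < 1.
Proof.
have h (a : R) : 0 < a -> 2 `^ (- a) < 1.
  move=> a0; rewrite powRN invf_lt1 ?powR_gt0//.
  have := @gt0_ltr_powR R a a0 1 2; rewrite powR1 !nnegrE; apply; lra.
by rewrite /scale_ratio lt_max powR_gt0//= gt_max !h// subr_gt0.
Qed.

Lemma energy_integrandE (F : T -> R) x y : 0 < dist x y ->
  ((`|F x - F y| `^ p / dist x y `^ q)%:E * (mu (B x (dist x y)))^-1 =
    (`|F x - F y| `^ p * kappa x y)%:E)%E.
Proof.
move=> xy; rewrite (mu_mball H)// inver gt_eqF ?(vol_gt0 H)//.
by rewrite -EFinM mulrA.
Qed.

Lemma energy_integrand0 (F : T -> R) x y : dist x y = 0 ->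
  ((`|F x - F y| `^ p / dist x y `^ q)%:E * (mu (B x (dist x y)))^-1 = 0)%E.
Proof.
move=> /[dup] xy /(dist_eq0 H) ->; rewrite subrr normr0 powR0 ?mul0r ?mul0e//.
by rewrite gt_eqF.
Qed.

(** The index j places D = d(x,y) dyadically with respect to [r]. If D >= r, the minimum is 1 and
    D^(-q) is at most 2^(-jq) r^(-q). If D < r, the gain (D/r)^p outweighs D^(-q) and leaves
    2^(-j(p-q)) r^(-q), up to 2^q. In both cases one doubling leads from the radius D to that of the
    kernel. *)
Lemma kappa_le x y r : 0 < dist x y -> 0 < r -> exists j,
  kappa x y * Num.min 1 (dist x y / r) `^ p <=
  A * 2 `^ q * (r `^ q)^-1 *
    (c ^+ j * (ker (2 ^+ j.+1 * r) x y + ker (r / 2 ^+ j) x y)).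
Proof.
move=> d0 r0; set D := dist x y.
have c0 : 0 < c by case/andP: scale_ratio01.
have k0 s : 0 <= ker s x y by exact: ker_ge0.
have [rd|dr] := leP r D.
  have [j /andP[j1 j2]] : exists j, 2 ^+ j <= D / r < 2 ^+ j.+1.
    by apply: dyadic_le; rewrite ler_pdivlMr// mul1r.
  rewrite ler_pdivlMr// in j1; rewrite ltr_pdivrMr// in j2.
  exists j; rewrite min_l; last by rewrite ler_pdivlMr// mul1r.
  rewrite powR1 mulr1 /besov_kernel.
  have e1 : (D `^ q)^-1 <= ((2 ^+ j * r) `^ q)^-1.
    rewrite lef_pV2 ?posrE ?powR_gt0//; last by rewrite mulr_gt0// exprn_gt0.
    by apply: ler_powR2r; rewrite ?(ltW q0)// mulr_ge0 ?exprn_ge0// ltW.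
  have e2 : (vol x D)^-1 <= A * ker (2 ^+ j.+1 * r) x y.
    rewrite /ball_kernel ifT//.
    have -> : A = A ^+ 1 by rewrite expr1.
    apply: (volV_le_exp H) => //; first by rewrite mulr_gt0// exprn_gt0.
    by rewrite (dist_xx H) add0r expr1 exprS -mulrA ler_pM2l.
  have e3 : ((2 ^+ j * r) `^ q)^-1 <= c ^+ j * (r `^ q)^-1.
    rewrite powRM ?exprn_ge0// ?(ltW r0)// invfM ler_wpM2r ?invr_ge0 ?powR_ge0//.
    rewrite -pow2N_exprn; apply: lerXn2r; rewrite ?nnegrE ?powR_ge0// ?(ltW c0)//.
    by rewrite /scale_ratio le_max lexx.
  apply: (@le_trans _ _ ((c ^+ j * (r `^ q)^-1) * (A * ker (2 ^+ j.+1 * r) x y))).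
    apply: ler_pM => //; rewrite ?invr_ge0 ?powR_ge0 ?fine_ge0//.
    exact: le_trans e3.
  rewrite (_ : _ * (A * _) = (A * 1 * (r `^ q)^-1) * (c ^+ j * ker (2 ^+ j.+1 * r) x y));
    last by ring.
  apply: ler_pM; rewrite ?mulr_ge0 ?exprn_ge0 ?invr_ge0 ?powR_ge0 ?(ltW c0)//.
    rewrite ler_wpM2r ?invr_ge0 ?powR_ge0// ler_wpM2l//.
    rewrite -[leLHS](powRr0 2); apply: ler_powR; [lra|exact: ltW].
  by rewrite ler_wpM2l ?exprn_ge0 ?(ltW c0)// lerDl.
have [j /andP[j1 j2]] : exists j, 2 ^+ j < r / D <= 2 ^+ j.+1.
  by apply: dyadic_lt; rewrite ltr_pdivlMr// mul1r.
rewrite ltr_pdivlMr// in j1; rewrite ler_pdivrMr// in j2.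
have t0 : 0 < 2 ^+ j :> R by rewrite exprn_gt0.
have t1 : 0 < 2 ^+ j.+1 :> R by rewrite exprn_gt0.
exists j; rewrite min_r; last by rewrite ler_pdivrMr// mul1r ltW.
rewrite /besov_kernel.
have e1 : (D `^ q)^-1 <= ((r / 2 ^+ j.+1) `^ q)^-1.
  rewrite lef_pV2 ?posrE ?powR_gt0//; last by rewrite divr_gt0.
  apply: ler_powR2r; rewrite ?(ltW q0)//; first by rewrite divr_ge0 ?(ltW r0) ?(ltW t1).
  by rewrite ler_pdivrMr// mulrC.
have e2 : (vol x D)^-1 <= A * ker (r / 2 ^+ j) x y.
  rewrite /ball_kernel ifT; last by rewrite ltr_pdivlMr// mulrC.
  have -> : A = A ^+ 1 by rewrite expr1.
  apply: (volV_le_exp H) => //; first by rewrite divr_gt0.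
  by rewrite (dist_xx H) add0r expr1 ler_pdivrMr// mulrAC -exprS.
have e3 : (D / r) `^ p <= ((2 ^+ j) `^ p)^-1.
  rewrite -inv_powR ?(ltW t0)//.
  apply: ler_powR2r; rewrite ?(ltW p0)//; first by rewrite divr_ge0 ?(ltW d0) ?(ltW r0).
  by rewrite ler_pdivrMr// ler_pdivlMl// ltW.
have e4 : ((r / 2 ^+ j.+1) `^ q)^-1 * ((2 ^+ j) `^ p)^-1 <=
    2 `^ q * (r `^ q)^-1 * c ^+ j.
  rewrite powRM ?(ltW r0) ?invr_ge0 ?(ltW t1)// invfM.
  rewrite inv_powR ?(ltW t1)// invrK.
  rewrite exprS powRM ?(ltW t0)//.
  have -> : (2 ^+ j) `^ p = (2 ^+ j) `^ q * (2 ^+ j) `^ (p - q).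
    by rewrite -powRD ?(gt_eqF t0) ?implybT// addrC subrK.
  rewrite invfM.
  rewrite (_ : _ * (_ * _) = 2 `^ q * (r `^ q)^-1 *
      ((2 ^+ j) `^ q * ((2 ^+ j) `^ q)^-1 * ((2 ^+ j) `^ (p - q))^-1)); last first.
    by ring.
  rewrite mulfV ?gt_eqF ?powR_gt0// mul1r.
  rewrite ler_wpM2l ?mulr_ge0 ?invr_ge0 ?powR_ge0//.
  rewrite -pow2N_exprn; apply: lerXn2r; rewrite ?nnegrE ?powR_ge0// ?(ltW c0)//.
  by rewrite /scale_ratio le_max lexx orbT.
apply: (@le_trans _ _ (((r / 2 ^+ j.+1) `^ q)^-1 * (A * ker (r / 2 ^+ j) x y) *
    ((2 ^+ j) `^ p)^-1)).
  apply: ler_pM => //; rewrite ?mulr_ge0 ?invr_ge0 ?powR_ge0 ?fine_ge0//.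
  by apply: ler_pM => //; rewrite ?invr_ge0 ?powR_ge0 ?fine_ge0.
rewrite mulrAC.
apply: (@le_trans _ _ ((2 `^ q * (r `^ q)^-1 * c ^+ j) * (A * ker (r / 2 ^+ j) x y))).
  by rewrite ler_wpM2r// mulr_ge0.
rewrite (_ : _ * (A * _) = A * 2 `^ q * (r `^ q)^-1 * (c ^+ j * ker (r / 2 ^+ j) x y));
  last by ring.
rewrite ler_wpM2l ?mulr_ge0 ?invr_ge0 ?powR_ge0//.
by rewrite ler_wpM2l ?exprn_ge0 ?(ltW c0)// lerDr.
Qed.

(** Since d(x,y) >= r / 2, the ball B(y, 2r) lies in B(x, 8 d(x,y)): three doublings. The kernel is
    centred at [y] to match [osc_integrand]. *)
Lemma kappa_shell_le x y r : 0 < r -> r / 2 <= dist x y < r ->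
  kappa x y <= A ^+ 3 * 2 `^ q * (r `^ q)^-1 * ker (2 * r) y x.
Proof.
move=> r0 /andP[h1 h2]; rewrite /besov_kernel.
have d0 : 0 < dist x y by lra.
have e1 : (dist x y `^ q)^-1 <= 2 `^ q * (r `^ q)^-1.
  rewrite -[2 `^ q]invrK -invfM -(@inv_powR _ 2)// -powRM ?invr_ge0 ?(ltW r0)//.
  rewrite lef_pV2 ?posrE ?powR_gt0//; last by rewrite mulr_gt0 ?invr_gt0.
  by apply: ler_powR2r; rewrite ?(ltW q0)// ?mulr_ge0 ?invr_ge0 ?(ltW r0)//; lra.
have e2 : (vol x (dist x y))^-1 <= A ^+ 3 * ker (2 * r) y x.
  rewrite /ball_kernel (dist_sym H y x) ifT; last by lra.
  by apply: (volV_le_exp H) => //; rewrite ?mulr_gt0// !exprS expr0; lra.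
apply: (@le_trans _ _ ((2 `^ q * (r `^ q)^-1) * (A ^+ 3 * ker (2 * r) y x))).
  by apply: ler_pM => //; rewrite ?invr_ge0 ?powR_ge0 ?fine_ge0.
by rewrite le_eqVlt; apply/orP; left; apply/eqP; ring.
Qed.

Lemma radius_gt0 k : 0 < rad k. Proof. by rewrite exprn_gt0// invr_gt0. Qed.

Lemma radiusS k : rad k.+1 = rad k / 2.
Proof. by rewrite /radius exprS mulrC. Qed.

Lemma measurable_scale_kernel r b : measurable_fun setT b ->
  (forall x, 0 <= b x)%E -> measurable_fun setT (scale r b).
Proof.
move=> mb b0; have c0 : 0 <= c by rewrite ltW//; case/andP: scale_ratio01.
have bb0 z : (0 <= b z.1 + b z.2 :> \bar R)%E by rewrite adde_ge0.
apply: ge0_emeasurable_sum => [j z _ _|j _].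
  rewrite mule_ge0 ?lee_fin ?exprn_ge0// adde_ge0// mule_ge0// lee_fin ker_ge0//.
apply: measurable_funeM; apply: emeasurable_funD; apply: (measurable_ker_mul H);
  by apply: emeasurable_funD; [exact: measurable_fst_comp|exact: measurable_snd_comp].
Qed.

Lemma scale_kernel_ge0 r b z : (forall x, 0 <= b x)%E -> (0 <= scale r b z)%E.
Proof.
move=> b0; have c0 : 0 <= c by rewrite ltW//; case/andP: scale_ratio01.
apply: nneseries_ge0 => j _ _; rewrite mule_ge0 ?lee_fin ?exprn_ge0//.
by rewrite adde_ge0// mule_ge0 ?adde_ge0// lee_fin ker_ge0.
Qed.

Lemma int_scale_kernel_le r b : 0 < r -> measurable_fun setT b ->
  (forall x, 0 <= b x)%E ->
  (\int[mu \x mu]_z scale r b z <=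
    ((1 - c)^-1 * (2 * (1 + A)))%:E * \int[mu]_x b x)%E.
Proof.
move=> r0 mb b0; have /andP[c0 c1] := scale_ratio01.
have bb0 z : (0 <= b z.1 + b z.2 :> \bar R)%E by rewrite adde_ge0.
have mk s : measurable_fun setT
    (fun z : T * T => (ker s z.1 z.2)%:E * (b z.1 + b z.2))%E.
  apply: (measurable_ker_mul H).
  by apply: emeasurable_funD; [exact: measurable_fst_comp|exact: measurable_snd_comp].
have kb0 s z : (0 <= (ker s z.1 z.2)%:E * (b z.1 + b z.2))%E.
  by rewrite mule_ge0// lee_fin ker_ge0.
have cj0 j : (0 <= (c ^+ j)%:E)%E by rewrite lee_fin exprn_ge0// ltW.
rewrite integral_nneseries//; last 2 first.
- by move=> j; apply: measurable_funeM; exact: emeasurable_funD.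
- by move=> j z _; rewrite mule_ge0// adde_ge0.
have intb0 : (0 <= \int[mu]_x b x)%E by apply: integral_ge0.
apply: (@le_trans _ _ (\sum_(j <oo) ((c ^+ j)%:E *
    ((2 * (1 + A))%:E * \int[mu]_x b x)))%E).
  apply: lee_nneseries => [j _ _|j _].
    by apply: integral_ge0 => z _; rewrite mule_ge0// adde_ge0.
  rewrite ge0_integralZl//; last 2 first.
  - exact: emeasurable_funD.
  - by move=> z _; rewrite adde_ge0.
  rewrite lee_wpmul2l// ge0_integralD//.
  rewrite mulr_natl mulr2n EFinD ge0_muleDl ?lee_fin ?addr_ge0//.
  apply: leeD; apply: (int_ker_mul_le H) => //.
    by rewrite mulr_gt0// exprn_gt0.
  by rewrite divr_gt0// exprn_gt0.
have [->|bfin] := eqVneq (\int[mu]_x b x)%E +oo%E.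
  rewrite [leRHS]gt0_muley ?leey// lte_fin mulr_gt0 ?invr_gt0 ?subr_gt0//.
  by rewrite mulr_gt0// ltr_pwDl.
have bE : (\int[mu]_x b x)%E \is a fin_num by rewrite ge0_fin_numE// ltey.
rewrite -(fineK bE); set y := fine _.
have -> : (\sum_(j <oo) ((c ^+ j)%:E * ((2 * (1 + A))%:E * y%:E)) =
    (2 * (1 + A) * y)%:E * \sum_(j <oo) (c ^+ j)%:E)%E.
  by rewrite -nneseriesZl//; apply: eq_eseriesr => j _; rewrite -EFinM muleC.
rewrite [leRHS](_ : _ = (2 * (1 + A) * y)%:E * ((1 - c)^-1)%:E)%E; last first.
  by rewrite -!EFinM; congr EFin; ring.
rewrite lee_wpmul2l//.
  by rewrite lee_fin !mulr_ge0 ?addr_ge0 ?fine_ge0.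
by apply: nneseries_geometric_le; rewrite c0.
Qed.

Lemma measurable_diff_powR (u : T -> R) : measurable_fun setT u ->
  measurable_fun setT (fun z : T * T => `|u z.1 - u z.2| `^ p).
Proof.
move=> mu0; apply: (measurableT_comp (measurable_powR p)).
apply: (measurableT_comp (@normr_measurable R setT)).
by apply: measurable_funB; [exact: measurable_fst_comp|exact: measurable_snd_comp].
Qed.

Lemma osc_ge0 u s x : (0 <= osc u s x)%E.
Proof. by apply: mean_ge0 => y; rewrite lee_fin powR_ge0. Qed.

Lemma measurable_osc_integrand u r : measurable_fun setT u ->
  measurable_fun setT (OSC u r).
Proof.
move=> mu0; apply: emeasurable_funM.
  apply/measurable_EFinP.
  have mswap : measurable_fun setT (fun z : T * T => (z.2, z.1)).
    by apply: measurable_fun_pair; [exact: measurable_snd|exact: measurable_fst].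
  exact: (measurableT_comp (measurable_ker H r) mswap).
by apply/measurable_EFinP; exact: measurable_diff_powR.
Qed.

Lemma osc_integrand_ge0 u r z : (0 <= OSC u r z)%E.
Proof. by rewrite mule_ge0// lee_fin ?ker_ge0 ?powR_ge0. Qed.

Lemma int_osc_integrand u r : measurable_fun setT u ->
  (\int[mu \x mu]_z OSC u r z = \int[mu]_y osc u r y)%E.
Proof.
move=> mu0; rewrite fubini_tonelli2//; first exact: measurable_osc_integrand.
by move=> z; exact: osc_integrand_ge0.
Qed.

Lemma measurable_osc u r : measurable_fun setT u -> measurable_fun setT (osc u r).
Proof.
move=> mu0.
apply: (measurable_fun_fubini_tonelli_G (OSC u r)).
  exact: measurable_osc_integrand.
by move=> z; exact: osc_integrand_ge0.
Qed.

(** The term in [u] is confined to a dyadic shell because only there is the Besov weight at most a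
    constant times r_k^(-q) times a ball kernel; on the whole ball of radius r_k the factor
    d(x,y)^(-q) is unbounded in general. On the shell the term integrates to the oscillation of
    [u]. *)
Lemma energy_le (u F : T -> R) (w : nat -> R) (b : nat -> T -> \bar R) :
  measurable_fun setT u -> (forall k, 0 <= w k) ->
  (forall k x, 0 <= b k x)%E -> (forall k, measurable_fun setT (b k)) ->
  (forall x y, 0 < dist x y -> ((`|F x - F y| `^ p)%:E <=
    \sum_(k <oo) (w k)%:E *
      (((Num.min 1 (dist x y / rad k) `^ p)%R)%:E * (b k x + b k y) +
       ((if rad k / 2 <= dist x y < rad k then `|u x - u y| `^ p else 0)%R)%:E))%E) ->
  (energy F <= ((1 - c)^-1 * (2 * (1 + A)) + 1)%:E * \sum_(k <oo)
    ((w k * (A ^+ 3 * 2 `^ q * (rad k `^ q)^-1))%:E *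
      (\int[mu]_x b k x + \int[mu]_x osc u (2 * rad k)%R x)))%E.
Proof.
move=> mu0 w0 b0 mb Fle; have /andP[c0 c1] := scale_ratio01.
pose C k := w k * (A ^+ 3 * 2 `^ q * (rad k `^ q)^-1).
have C0 k : (0 <= (C k)%:E)%E.
  by rewrite lee_fin !mulr_ge0 ?exprn_ge0 ?invr_ge0 ?powR_ge0.
pose M z : \bar R := (\sum_(k <oo) ((C k)%:E *
  (scale (rad k) (b k) z + OSC u (2 * rad k)%R z)))%E.
have S0 k z : (0 <= scale (rad k) (b k) z)%E by exact: scale_kernel_ge0.
have mS k : measurable_fun setT (scale (rad k) (b k)) by exact: measurable_scale_kernel.
have mO k : measurable_fun setT (OSC u (2 * rad k)%R).
  exact: measurable_osc_integrand.
have O0 k z : (0 <= OSC u (2 * rad k)%R z)%E by exact: osc_integrand_ge0.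
have M0 z : (0 <= M z)%E by apply: nneseries_ge0 => k _ _; rewrite mule_ge0// adde_ge0.
have mM : measurable_fun setT M.
  apply: ge0_emeasurable_sum => [k z _ _|k _]; first by rewrite mule_ge0// adde_ge0.
  by apply: measurable_funeM; exact: emeasurable_funD.
have E0 x y : (0 <= (`|F x - F y| `^ p / dist x y `^ q)%:E *
    (mu (B x (dist x y)))^-1)%E.
  by rewrite mule_ge0 ?inve_ge0// lee_fin divr_ge0// powR_ge0.
(* The energy is dominated pointwise by the jointly measurable [M], and Tonelli is applied to [M]
   alone. *)
have step : (energy F <= \int[mu]_y \int[mu]_x M (x, y))%E.
  apply: ge0_le_integralT => y; first by apply: integral_ge0.
  apply: ge0_le_integralT => x //.
  have := dist_ge0 H x y; rewrite le_eqVlt => /predU1P[d0|d0].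
    by rewrite energy_integrand0.
  rewrite energy_integrandE// EFinM muleC.
  have k0 : 0 <= kappa x y by rewrite mulr_ge0// invr_ge0 ?powR_ge0 ?fine_ge0.
  apply: le_trans (lee_wpmul2l _ (Fle x y d0)) _; first by rewrite lee_fin.
  have t0 k : (0 <= ((if rad k / 2 <= dist x y < rad k then `|u x - u y| `^ p else 0)%R)%:E)%E.
    by case: ifP => // _; rewrite lee_fin powR_ge0.
  rewrite -nneseriesZl; last first.
    move=> k _; rewrite mule_ge0 ?lee_fin// adde_ge0// mule_ge0 ?adde_ge0//.
    by rewrite lee_fin powR_ge0.
  apply: lee_nneseries => [k _ _|k _].
    rewrite mule_ge0 ?lee_fin// mule_ge0 ?lee_fin// adde_ge0// mule_ge0 ?adde_ge0//.
    by rewrite lee_fin powR_ge0.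
  rewrite muleCA (_ : (C k)%:E = ((w k)%:E * (A ^+ 3 * 2 `^ q * (rad k `^ q)^-1)%R%:E)%E)//.
  rewrite -[leRHS]muleA; apply: lee_wpmul2l; first by rewrite lee_fin.
  have bb0 : (0 <= b k x + b k y)%E by rewrite adde_ge0.
  rewrite [leRHS]ge0_muleDr// [leLHS]ge0_muleDr//; last first.
    by rewrite mule_ge0// lee_fin powR_ge0.
  apply: leeD.
    rewrite muleA -EFinM.
    have [j hj] := kappa_le d0 (radius_gt0 k).
    apply: (@le_trans _ _ ((A * 2 `^ q * (rad k `^ q)^-1)%R%:E *
       ((c ^+ j)%:E * ((ker (2 ^+ j.+1 * rad k)%R x y)%:E * (b k x + b k y) +
       (ker (rad k / 2 ^+ j)%R x y)%:E * (b k x + b k y))))%E).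
      rewrite -ge0_muleDl ?lee_fin ?ker_ge0// -EFinD.
      rewrite [X in (_ <= _ * X)%E]muleA [leRHS]muleA -!EFinM.
      by rewrite lee_wpmul2r// lee_fin.
    apply: lee_pmul => //.
    - by rewrite lee_fin !mulr_ge0 ?invr_ge0 ?powR_ge0.
    - rewrite mule_ge0 ?lee_fin ?exprn_ge0 ?(ltW c0)// adde_ge0// mule_ge0//;
        by rewrite lee_fin ker_ge0.
    - rewrite lee_fin ler_wpM2r ?invr_ge0 ?powR_ge0// ler_wpM2r ?powR_ge0//.
      exact: ler_eXnr.
    - apply: (@nneseries_term_le _ (fun j => (c ^+ j)%:E *
       ((ker (2 ^+ j.+1 * rad k)%R x y)%:E * (b k x + b k y) +
       (ker (rad k / 2 ^+ j)%R x y)%:E * (b k x + b k y)))%E) => i.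
      rewrite mule_ge0 ?lee_fin ?exprn_ge0 ?(ltW c0)// adde_ge0// mule_ge0//;
        by rewrite lee_fin ker_ge0.
  case: ifPn => [h|_]; last first.
    by rewrite mule0 mule_ge0// lee_fin !mulr_ge0 ?exprn_ge0 ?invr_ge0 ?powR_ge0.
  rewrite /osc_integrand/= muleA -!EFinM lee_fin ler_wpM2r ?powR_ge0//.
  exact: (kappa_shell_le (radius_gt0 k)).
apply: (le_trans step); rewrite -(fubini_tonelli2 M)//.
rewrite integral_nneseries//; last 2 first.
- by move=> k; apply: measurable_funeM; exact: emeasurable_funD.
- by move=> k z _; rewrite mule_ge0// adde_ge0.
have ib0 k : (0 <= \int[mu]_x b k x)%E by apply: integral_ge0.
have io0 k : (0 <= \int[mu]_x osc u (2 * rad k)%R x)%E.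
  by apply: integral_ge0 => x _; exact: osc_ge0.
have D1 : 0 <= (1 - c)^-1 * (2 * (1 + A)).
  apply: mulr_ge0; first by rewrite invr_ge0 subr_ge0 ltW.
  by rewrite mulr_ge0// addr_ge0.
rewrite -nneseriesZl; last first.
  by move=> k _; apply: mule_ge0; [exact: C0|exact: adde_ge0].
apply: lee_nneseries => [k _ _|k _].
  by apply: integral_ge0 => z _; rewrite mule_ge0// adde_ge0.
rewrite ge0_integralZl//; last 2 first.
- exact: emeasurable_funD.
- by move=> z _; rewrite adde_ge0.
rewrite muleCA; apply: lee_wpmul2l => //; rewrite ge0_integralD// int_osc_integrand//.
rewrite ge0_muleDr//; apply: leeD.
  apply: (le_trans (int_scale_kernel_le (radius_gt0 k) (mb k) (b0 k))).
  by rewrite lee_wpmul2r// lee_fin lerDl.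
rewrite -[leLHS]mul1e lee_wpmul2r// lee_fin lerDr//.
Qed.

End energy_upper_bound.

(** * Lower bound for the energy by oscillations *)

Section energy_lower_bound.
Context d (T : measurableType d) (R : realType)
  (mu : {sigma_finite_measure set T -> \bar R}) (dist : T -> T -> R) (A : R).
Hypothesis H : doubling_space mu dist A.
Variables p q : R.
Hypotheses (q0 : 0 < q) (qp : q < p).

Local Notation B := (mball dist).
Local Notation vol := (vol mu dist).
Local Notation ker := (ball_kernel mu dist).
Local Notation mean := (mean mu dist).
Local Notation energy := (energy mu dist p q).
Local Notation osc := (osc mu dist p).
Local Notation OSC := (osc_integrand mu dist p).

Let A1 : 1 <= A. Proof. exact: doubling_ge1 H. Qed.
Let A0 : 0 <= A. Proof. exact: le_trans ler01 A1. Qed.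
Let A0' : 0 < A. Proof. exact: lt_le_trans ltr01 A1. Qed.

Let p0 : 0 < p. Proof. exact: lt_trans qp. Qed.

Local Notation c := (scale_ratio p q).
Local Notation kappa := (besov_kernel mu dist q).
Local Notation rad := (radius R).
Local Notation scale := (scale_kernel mu dist p q).

(** A geometric sum is governed by its last term, and 2^k < M gives Q^k <= M^q. *)
Lemma sum_exprn_lt (M Q : R) n : 1 < Q -> Q = 2 `^ q -> 0 < M ->
  \sum_(0 <= k < n) (if 2 ^+ k < M then Q ^+ k else 0) <= Q / (Q - 1) * M `^ q.
Proof.
move=> Q1 QE M0; have Q10 : 0 < Q - 1 by lra.
elim: n => [|n IH].
  by rewrite big_nil mulr_ge0 ?powR_ge0// divr_ge0//; lra.
have [nM|Mn] := ltP (2 ^+ n) M; last by rewrite big_nat_recr//= ltNge Mn/= addr0.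
apply: (@le_trans _ _ (\sum_(0 <= k < n.+1) Q ^+ k)).
  by apply: ler_sum => k _; case: ifP => // _; rewrite exprn_ge0//; lra.
have -> : \sum_(0 <= k < n.+1) Q ^+ k = (Q ^+ n.+1 - 1) / (Q - 1).
  by rewrite subrX1 big_mkord [X in _ = X / _]mulrC mulfK// gt_eqF.
rewrite mulrAC ler_pM2r ?invr_gt0// exprS.
have QnM : Q ^+ n <= M `^ q.
  by rewrite QE -powR_exprn// ler_powR2r ?ltW// exprn_ge0.
apply: (@le_trans _ _ (Q * Q ^+ n)); first by lra.
by rewrite ler_pM2l//; lra.
Qed.

(** A pair at distance d is seen by the kernel of radius 2 r_k only if 2^k < 2 / d. The inverse
    volumes of these balls are at most [A] times that of B(x, d), and the factors r_k^(-q) = Q^k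
    form a geometric sum of order d^(-q). *)
Lemma energy_ge (u : T -> R) : measurable_fun setT u -> exists2 C, 0 < C &
  (\sum_(k <oo) ((C * (rad k `^ q)^-1)%:E * \int[mu]_y osc u (2 * rad k)%R y) <=
    energy u)%E.
Proof.
move=> mu0; pose Q : R := 2 `^ q.
have Q1 : 1 < Q.
  have := @gt0_ltr_powR R q q0 1 2; rewrite powR1 !nnegrE; apply; lra.
have Q10 : 0 < Q - 1 by lra.
have sQ k : (rad k `^ q)^-1 = Q ^+ k.
  by rewrite /radius exprVn inv_powR ?exprn_ge0// invrK powR_exprn.
(* The factors come from the change of ball, from the geometric sum, and from the 2^q in (2 /
   d)^q. *)
pose D : R := A * (Q / (Q - 1)) * Q.
have Q0 : 0 < Q by lra.
have D0 : 0 < D.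
  by apply: mulr_gt0 => //; apply: mulr_gt0; [exact: A0'|exact: divr_gt0].
exists D^-1; first by rewrite invr_gt0.
pose N z : \bar R := (\sum_(k <oo) ((D^-1 * (rad k `^ q)^-1)%:E *
  OSC u (2 * rad k)%R z))%E.
have C0 k : (0 <= (D^-1 * (rad k `^ q)^-1)%:E)%E.
  by rewrite lee_fin mulr_ge0 ?invr_ge0 ?powR_ge0 ?ltW.
have mO k : measurable_fun setT (OSC u (2 * rad k)%R).
  exact: (measurable_osc_integrand H).
have N0 z : (0 <= N z)%E.
  by apply: nneseries_ge0 => k _ _; rewrite mule_ge0// osc_integrand_ge0.
have mN : measurable_fun setT N.
  apply: ge0_emeasurable_sum => [k z _ _|k _].
    by rewrite mule_ge0// osc_integrand_ge0.
  exact: measurable_funeM.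
rewrite (_ : (\sum_(k <oo) _)%E = (\int[mu \x mu]_z N z)%E); last first.
  rewrite integral_nneseries//; last 2 first.
  - by move=> k; exact: measurable_funeM.
  - by move=> k z _; rewrite mule_ge0// osc_integrand_ge0.
  apply: eq_eseriesr => k _; rewrite ge0_integralZl//.
    by rewrite (int_osc_integrand H).
  by move=> z _; exact: osc_integrand_ge0.
rewrite fubini_tonelli2//.
apply: ge0_le_integralT => y; first by apply: integral_ge0.
apply: ge0_le_integralT => x //=.
have := dist_ge0 H x y; rewrite le_eqVlt => /predU1P[d0|d0].
  rewrite (energy_integrand0 H)// /N eseries0// => k _ _.
  rewrite /osc_integrand/= (dist_eq0 H (esym d0)) subrr normr0 powR0 ?gt_eqF//.
  by rewrite !mule0.
rewrite (energy_integrandE H)//.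
have term0 k : (0 <= (D^-1 * (rad k `^ q)^-1)%:E * OSC u (2 * rad k)%R (x, y))%E.
  by rewrite mule_ge0// osc_integrand_ge0.
apply: nneseries_le => // n.
rewrite /osc_integrand/=; under eq_bigr do rewrite -!EFinM.
rewrite sumEFin lee_fin mulrC; under eq_bigr do rewrite mulrA.
rewrite -mulr_suml ler_wpM2r ?powR_ge0//.
have vol0 : 0 < vol x (dist x y) by exact: vol_gt0 H _ _ _.
apply: (@le_trans _ _ (\sum_(0 <= k < n) (D^-1 * A * (vol x (dist x y))^-1) *
    (if 2 ^+ k < 2 / dist x y then Q ^+ k else 0))).
  apply: ler_sum => k _; rewrite sQ /ball_kernel.
  have -> : (dist y x < 2 * rad k) = (2 ^+ k < 2 / dist x y).
    by rewrite (dist_sym H y x) ltr_pdivlMr// /radius exprVn ltr_pdivlMr ?exprn_gt0// mulrC.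
  case: ifPn => h; last by rewrite !mulr0.
  have e : (vol y (2 * rad k))^-1 <= A * (vol x (dist x y))^-1.
    have -> : A = A ^+ 1 by rewrite expr1.
    apply: (volV_le_exp H) => //; first by rewrite mulr_gt0// radius_gt0.
    rewrite (dist_sym H y x) expr1.
    have : dist x y < 2 * rad k.
      by rewrite /radius exprVn ltr_pdivlMr ?exprn_gt0// mulrC -ltr_pdivlMr.
    by lra.
  have := ler_wpM2l (_ : 0 <= D^-1 * Q ^+ k) e.
  have -> : D^-1 * Q ^+ k * (A * (vol x (dist x y))^-1) =
    D^-1 * A * (vol x (dist x y))^-1 * Q ^+ k by ring.
  by apply; rewrite mulr_ge0 ?invr_ge0 ?exprn_ge0 ?ltW//; lra.
rewrite -mulr_sumr.
have h := @sum_exprn_lt (2 / dist x y) Q n Q1 erefl (divr_gt0 (ltr0Sn _ _) d0).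
apply: (@le_trans _ _ (D^-1 * A * (vol x (dist x y))^-1 *
    (Q / (Q - 1) * (2 / dist x y) `^ q))).
  by rewrite ler_wpM2l// !mulr_ge0 ?invr_ge0 ?(ltW D0) ?(ltW vol0).
rewrite powRM ?invr_ge0 ?(ltW d0)// inv_powR ?(ltW d0)//.
rewrite /besov_kernel le_eqVlt; apply/orP; left; apply/eqP.
rewrite -/Q; have AQ : A * (Q / (Q - 1)) * Q != 0 by rewrite gt_eqF.
have -> : D^-1 * A / vol x (dist x y) * (Q / (Q - 1) * (Q / dist x y `^ q)) =
  (D^-1 * D) * ((dist x y `^ q)^-1 / vol x (dist x y)).
  by rewrite /D; ring.
by rewrite mulVf// mul1r.
Qed.

End energy_lower_bound.

(** * Lipschitz averaging kernels *)

(** A mean over a ball need not depend continuously on the centre, as the volume may jump. The tent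
    is Lipschitz in its centre, and still comparable to ball kernels from both sides. *)
Definition tent (R : realType) T (dist : T -> T -> R) (r : R) x y : R :=
  Num.max 0 (r - dist x y).

Definition tent_mass d (T : measurableType d) (R : realType)
    (mu : {sigma_finite_measure set T -> \bar R}) (dist : T -> T -> R) r x : R :=
  \int[mu]_y tent dist r x y.

Definition smooth_kernel d (T : measurableType d) (R : realType)
    (mu : {sigma_finite_measure set T -> \bar R}) (dist : T -> T -> R) r x y : R :=
  tent dist r x y / tent_mass mu dist r x.

Definition smooth_mean d (T : measurableType d) (R : realType)
    (mu : {sigma_finite_measure set T -> \bar R}) (dist : T -> T -> R)
    (u : T -> R) r x : R :=
  \int[mu]_y (smooth_kernel mu dist r x y * u y).

Section smooth_mean.
Context d (T : measurableType d) (R : realType)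
  (mu : {sigma_finite_measure set T -> \bar R}) (dist : T -> T -> R) (A : R).
Hypothesis H : doubling_space mu dist A.

Local Notation B := (mball dist).
Local Notation vol := (vol mu dist).
Local Notation ker := (ball_kernel mu dist).
Local Notation mean := (mean mu dist).
Local Notation osc := (osc mu dist).
Local Notation hat := (tent dist).
Local Notation mass := (tent_mass mu dist).
Local Notation psi := (smooth_kernel mu dist).

Let A1 : 1 <= A. Proof. exact: doubling_ge1 H. Qed.
Let A0 : 0 <= A. Proof. exact: le_trans ler01 A1. Qed.
Let A0' : 0 < A. Proof. exact: lt_le_trans ltr01 A1. Qed.

Lemma tent_ge0 r x y : 0 <= hat r x y.
Proof. by rewrite /tent le_max lexx. Qed.

Lemma measurable_tent r x : measurable_fun setT (hat r x).
Proof.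
apply: measurable_maxr; first exact: measurable_cst.
apply: measurable_funB; first exact: measurable_cst.
exact: (measurable_fun_pair2 _ (measurable_dist H)).
Qed.

Lemma tent_le_ker r x y : 0 < r -> hat r x y <= r * vol x r * ker r x y.
Proof.
move=> r0; have v0 := vol_gt0 H x r0; have d0 := dist_ge0 H x y.
rewrite /ball_kernel /tent; case: ltP => h.
  by rewrite mulfK ?gt_eqF// ge_max ltW//=; lra.
by rewrite mulr0 ge_max lexx/=; lra.
Qed.

Lemma tent_ge_ker r x y : 0 < r ->
  r / 2 * vol x (r / 2) * ker (r / 2) x y <= hat r x y.
Proof.
move=> r0; have r20 : 0 < r / 2 by lra.
have v0 := vol_gt0 H x r20; have d0 := dist_ge0 H x y.
rewrite /ball_kernel /tent; case: ltP => h.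
  by rewrite mulfK ?gt_eqF// le_max; apply/orP; right; lra.
by rewrite mulr0 le_max lexx.
Qed.

(** The ball kernel has integral 1, so a bound by a multiple of it gives integrability and the size
    of the integral together. Tents, smooth kernels and their differences all enter this way. *)
Lemma integrable_le_ker (k : T -> R) K s x : 0 < s -> 0 <= K ->
  measurable_fun setT k -> (forall z, `|k z| <= K * ker s x z) ->
  mu.-integrable setT (EFin \o k) /\ `|\int[mu]_z k z| <= K.
Proof.
move=> s0 K0 mk kK.
have h : (\int[mu]_z `|(k z)%:E| <= K%:E)%E.
  apply: (@le_trans _ _ (\int[mu]_z (K%:E * (ker s x z)%:E)))%E.
    by apply: ge0_le_integralT => z //=; rewrite -EFinM lee_fin.
  rewrite ge0_integralZl//; last 2 first.
  - by apply/measurable_EFinP; exact: measurable_ker_r H _ _.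
  - by move=> z _; rewrite lee_fin ker_ge0.
  by rewrite (int_kerr H)// mule1.
have ik : mu.-integrable setT (EFin \o k).
  apply/integrableP; split; first exact/measurable_EFinP.
  by apply: le_lt_trans h _; rewrite ltry.
split => //; apply: le_trans (le_normr_Rintegral measurableT ik) _.
by rewrite -lee_fin /Rintegral fineK//; apply/integral_fune_fin_num => //; exact: integrable_norm.
Qed.

Lemma integrable_ker s x : 0 < s -> mu.-integrable setT (EFin \o ker s x) /\
  \int[mu]_z ker s x z = 1.
Proof.
move=> s0; have [|||//|ik _] := @integrable_le_ker (ker s x) 1 s x.
- by [].
- by [].
- exact: measurable_ker_r H _ _.
- by move=> z; rewrite mul1r ger0_norm// ker_ge0.
by split => //; rewrite /Rintegral (int_kerr H).
Qed.

Lemma integrable_tent r x : 0 < r -> mu.-integrable setT (EFin \o hat r x).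
Proof.
move=> r0; have v0 := vol_gt0 H x r0.
have [|||//|] := @integrable_le_ker (hat r x) (r * vol x r) r x => //.
- by rewrite mulr_ge0// ltW.
- exact: measurable_tent.
- by move=> z; rewrite ger0_norm ?tent_ge0// tent_le_ker.
Qed.

(** On B(x, r / 2) the tent is at least [r / 2], and by one doubling this ball has at least the
    fraction 1 / A of the volume. *)
Lemma mass_ge r x : 0 < r -> r * vol x r / (2 * A) <= mass r x.
Proof.
move=> r0; have r20 : 0 < r / 2 by lra.
have [ik i1] := integrable_ker x r20.
apply: (@le_trans _ _ (r / 2 * vol x (r / 2))).
  rewrite ler_pdivrMr ?mulr_gt0//.
  have -> : r / 2 * vol x (r / 2) * (2 * A) = r * (A * vol x (r / 2)) by field.
  rewrite ler_pM2l//; apply: le_trans (vol_doubling H x r20).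
  by rewrite mulrC divfK.
rewrite -[leLHS]mulr1 -[X in _ * X]i1 -RintegralZl//.
apply: le_Rintegral => //.
- exact: (integrableZl measurableT _ ik).
- exact: integrable_tent.
- by move=> y _; exact: tent_ge_ker.
Qed.

Lemma mass_gt0 r x : 0 < r -> 0 < mass r x.
Proof.
move=> r0; apply: lt_le_trans (mass_ge x r0).
by rewrite divr_gt0 ?mulr_gt0// (vol_gt0 H).
Qed.

Lemma psi_ge0 r x y : 0 < r -> 0 <= psi r x y.
Proof. by move=> r0; rewrite divr_ge0 ?tent_ge0// ltW// mass_gt0. Qed.

Lemma measurable_psi r x : measurable_fun setT (psi r x).
Proof. by apply: measurable_funM; [exact: measurable_tent|exact: measurable_cst]. Qed.

Lemma psi_le_ker r x y : 0 < r -> psi r x y <= 2 * A * ker r x y.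
Proof.
move=> r0; have v0 := vol_gt0 H x r0.
rewrite ler_pdivrMr ?mass_gt0//; apply: le_trans (tent_le_ker x y r0) _.
have := mass_ge x r0; rewrite ler_pdivrMr ?mulr_gt0// => h.
apply: le_trans (ler_wpM2r (ker_ge0 _ _ _ _ _) h) _.
by rewrite le_eqVlt; apply/orP; left; apply/eqP; ring.
Qed.

Lemma int_psi r x : 0 < r -> \int[mu]_y psi r x y = 1.
Proof.
move=> r0; rewrite RintegralZr//; last exact: integrable_tent.
by rewrite mulfV// gt_eqF// mass_gt0.
Qed.

Lemma tent_lipschitz r x x' z : 0 < r -> dist x x' < r ->
  `|hat r x z - hat r x' z| <= dist x x' * vol x (2 * r) * ker (2 * r) x z.
Proof.
move=> r0 xx'; have r20 : 0 < 2 * r by lra.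
have v0 := vol_gt0 H x r20.
have t1 := dist_triangle H x' x z; have t2 := dist_triangle H x x' z.
rewrite (dist_sym H x' x) in t2.
have d0 := dist_ge0 H x z; have d1 := dist_ge0 H x' z; have d2 := dist_ge0 H x x'.
rewrite /ball_kernel; case: ltP => h.
  rewrite mulfK ?gt_eqF// /tent.
  case: (ltP 0 (r - dist x z)) => h1; case: (ltP 0 (r - dist x' z)) => h2;
    rewrite ler_norml; apply/andP; split; lra.
rewrite mulr0 /tent max_l; last by lra.
by rewrite max_l ?subrr ?normr0//; lra.
Qed.

Lemma mass_lipschitz r x x' : 0 < r -> dist x x' < r ->
  `|mass r x - mass r x'| <= dist x x' * vol x (2 * r).
Proof.
move=> r0 xx'; have r20 : 0 < 2 * r by lra.
rewrite -RintegralB//; [|exact: integrable_tent..].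
have [|||//|//] := @integrable_le_ker (fun z => hat r x z - hat r x' z)
    (dist x x' * vol x (2 * r)) (2 * r) x => //.
- by rewrite mulr_ge0 ?(dist_ge0 H)// ltW// (vol_gt0 H).
- by apply: measurable_funB; exact: measurable_tent.
- by move=> z; exact: tent_lipschitz.
Qed.

(** A quotient rule: [2 * A ^+ 2] comes from the variation of the tent divided by the mass at [x],
    and [4 * A ^+ 5] is the product of [2 * A ^+ 3] and [2 * A ^+ 2], from the variation of the mass
    divided by both masses. *)
Lemma psi_lipschitz r x x' z : 0 < r -> dist x x' < r ->
  `|psi r x z - psi r x' z| <=
    (2 * A ^+ 2 + 4 * A ^+ 5) * (dist x x' / r) * ker (2 * r) x z.
Proof.
move=> r0 xx'; have r20 : 0 < 2 * r by lra.
have v0 := vol_gt0 H x r20.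
have d0 := dist_ge0 H x x'.
have t1 := dist_triangle H x' x z; have t2 := dist_triangle H x x' z.
rewrite (dist_sym H x' x) in t2.
have M0 := mass_gt0 x r0; have M0' := mass_gt0 x' r0.
have k0 := ker_ge0 mu dist (2 * r) x z.
set V := vol x (2 * r) in v0 *.
have MV : V * r <= 2 * A ^+ 2 * mass r x.
  have := mass_ge x r0; rewrite ler_pdivrMr ?mulr_gt0// => h.
  have h2 : V <= A * vol x r by exact: vol_doubling H _ _ r0.
  apply: (@le_trans _ _ (A * (r * vol x r))); first by nra.
  have -> : 2 * A ^+ 2 * mass r x = A * (mass r x * (2 * A)) by ring.
  by rewrite ler_pM2l.
have MV' : V * r <= 2 * A ^+ 3 * mass r x'.
  have := mass_ge x' r0; rewrite ler_pdivrMr ?mulr_gt0// => h.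
  have h2 : V <= A ^+ 2 * vol x' r.
    apply: (vol_le_exp H) => //; rewrite (dist_sym H x' x) expr2; lra.
  apply: (@le_trans _ _ (A ^+ 2 * (r * vol x' r))).
    by rewrite mulrCA mulrC; rewrite ler_pM2l.
  have -> : 2 * A ^+ 3 * mass r x' = A ^+ 2 * (mass r x' * (2 * A)) by ring.
  by rewrite ler_pM2l// exprn_gt0.
have tz' : hat r x' z <= r * (V * ker (2 * r) x z).
  have := dist_ge0 H x' z => d1.
  rewrite /ball_kernel; case: ltP => h; rewrite /tent.
    by rewrite mulfV ?gt_eqF// ge_max; apply/andP; split; lra.
  by rewrite !mulr0 ge_max lexx/=; lra.
have tz0 := tent_ge0 r x' z.
have -> : psi r x z - psi r x' z =
    (hat r x z - hat r x' z) / mass r x +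
    hat r x' z / mass r x' * ((mass r x' - mass r x) / mass r x).
  rewrite /smooth_kernel; field.
  by rewrite !gt_eqF.
apply: le_trans (ler_normD _ _) _.
rewrite !normrM !normfV (ger0_norm tz0) (gtr0_norm M0) (gtr0_norm M0').
have h1 : (mass r x)^-1 <= 2 * A ^+ 2 / (V * r).
  by rewrite ler_pdivlMr ?mulr_gt0// mulrC ler_pdivrMr.
have h1' : (mass r x')^-1 <= 2 * A ^+ 3 / (V * r).
  by rewrite ler_pdivlMr ?mulr_gt0// mulrC ler_pdivrMr.
have e1 : `|hat r x z - hat r x' z| / mass r x <=
    (dist x x' * V * ker (2 * r) x z) * (2 * A ^+ 2 / (V * r)).
  by apply: ler_pM; rewrite ?invr_ge0 ?(ltW M0)//; exact: tent_lipschitz.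
have e2 : hat r x' z / mass r x' * (`|mass r x' - mass r x| / mass r x) <=
    (r * (V * ker (2 * r) x z) * (2 * A ^+ 3 / (V * r))) *
    (dist x x' * V * (2 * A ^+ 2 / (V * r))).
  apply: ler_pM; rewrite ?mulr_ge0 ?invr_ge0 ?(ltW M0) ?(ltW M0')//.
    by apply: ler_pM; rewrite ?invr_ge0 ?(ltW M0')//.
  apply: ler_pM; rewrite ?invr_ge0 ?(ltW M0)//.
  by rewrite distrC; exact: mass_lipschitz.
apply: le_trans (lerD e1 e2) _.
rewrite le_eqVlt; apply/orP; left; apply/eqP; field.
by rewrite !gt_eqF.
Qed.

End smooth_mean.

(** * Sup-convolutions *)

(** Taking y = x shows that this is a majorant of [G]; the cut-off makes it Lipschitz at scale [r].
    Continuity will make the exceptional sets open, the Lipschitz bound will control the energy. *)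
Definition sup_convolution (R : realType) T (dist : T -> T -> R) (r : R)
    (G : T -> R) x : R :=
  sup (range (fun y => G y * Num.max 0 (1 - dist x y / r))).

Section sup_convolution.
Context d (T : measurableType d) (R : realType)
  (mu : {sigma_finite_measure set T -> \bar R}) (dist : T -> T -> R) (A : R).
Hypothesis H : doubling_space mu dist A.
Variables (r : R) (G M : T -> R).
Hypotheses (r0 : 0 < r) (G0 : forall x, 0 <= G x)
  (GM : forall x y, dist x y < 2 * r -> G y <= M x).

Local Notation W := (sup_convolution dist r G).

Let M0 x : 0 <= M x.
Proof. by apply: le_trans (GM _); [exact: G0 x|rewrite (dist_xx H) mulr_gt0]. Qed.

Let cut_le1 x y : Num.max 0 (1 - dist x y / r) <= 1.
Proof. by rewrite ge_max ler01 gerBl divr_ge0 ?(dist_ge0 H) ?ltW. Qed.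

Let term_le x y : G y * Num.max 0 (1 - dist x y / r) <= M x.
Proof.
have [h|h] := ltP (dist x y) r.
  apply: le_trans (GM _); last by apply: (lt_le_trans h); have := r0; lra.
  by rewrite ler_piMr.
by rewrite max_l ?mulr0// subr_le0 ler_pdivlMr// mul1r.
Qed.

Let has_sup_term x : has_sup (range (fun y => G y * Num.max 0 (1 - dist x y / r))).
Proof.
split; first by exists (G x * Num.max 0 (1 - dist x x / r)); exists x.
by exists (M x) => _ [y _ <-].
Qed.

Lemma sup_convolution_ge_term x y : G y * Num.max 0 (1 - dist x y / r) <= W x.
Proof. by apply: ub_le_sup; [case: (has_sup_term x)|exists y]. Qed.

Lemma sup_convolution_le x : W x <= M x.
Proof. by apply: ge_sup; [case: (has_sup_term x)|move=> _ [y _ <-]]. Qed.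

Lemma sup_convolution_ge x : G x <= W x.
Proof.
apply: le_trans (sup_convolution_ge_term x x).
by rewrite (dist_xx H) mul0r subr0 max_r// mulr1.
Qed.

(** Each cut-off is Lipschitz with constant 1 / r. The points [y] that matter lie within [r] of [x]
    or of [x'], hence within [2 * r] of [x], which is why [GM] reaches that far. *)
Lemma sup_convolution_lipschitz x x' : dist x x' < r ->
  `|W x - W x'| <= dist x x' / r * M x.
Proof.
move=> xx'; have r0' := r0.
have d0 : 0 <= dist x x' / r by rewrite divr_ge0 ?(dist_ge0 H) ?ltW.
have tri y : `|Num.max 0 (1 - dist x y / r) - Num.max 0 (1 - dist x' y / r)| <=
    dist x x' / r.
  have t1 : dist x y / r <= dist x x' / r + dist x' y / r.
    by rewrite -mulrDl ler_pM2r ?invr_gt0// (dist_triangle H).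
  have t2 : dist x' y / r <= dist x x' / r + dist x y / r.
    by rewrite -mulrDl ler_pM2r ?invr_gt0// (dist_sym H x x') (dist_triangle H).
  rewrite ler_norml; case: (ltP 0 (1 - dist x y / r)) => h1;
    case: (ltP 0 (1 - dist x' y / r)) => h2; apply/andP; split; lra.
rewrite ler_distl; apply/andP; split.
- rewrite lerBlDr; apply: ge_sup; first by case: (has_sup_term x').
  move=> _ [y _ <-].
  have [h|h] := ltP (dist x' y) r; last first.
    rewrite [X in _ * X]max_l ?mulr0; last by rewrite subr_le0 ler_pdivlMr// mul1r.
    apply: addr_ge0; last exact: mulr_ge0.
    exact: le_trans (sup_convolution_ge x).
  have GyM : G y <= M x.
    by apply: GM; have := dist_triangle H x' x y; lra.
  have := sup_convolution_ge_term x y.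
  have := tri y; rewrite ler_norml => /andP[h1 h2].
  have Gy := G0 y.
  have : G y * Num.max 0 (1 - dist x' y / r) <=
    G y * Num.max 0 (1 - dist x y / r) + G y * (dist x x' / r).
    by rewrite -mulrDr ler_wpM2l//; lra.
  have : G y * (dist x x' / r) <= M x * (dist x x' / r) by rewrite ler_wpM2r.
  by rewrite [M x * _]mulrC; lra.
- apply: ge_sup; first by case: (has_sup_term x).
  move=> _ [y _ <-].
  have [h|h] := ltP (dist x y) r; last first.
    rewrite [X in _ * X]max_l ?mulr0; last by rewrite subr_le0 ler_pdivlMr// mul1r.
    apply: addr_ge0; last exact: mulr_ge0.
    exact: le_trans (sup_convolution_ge x').
  have GyM : G y <= M x by apply: GM; lra.
  have := sup_convolution_ge_term x' y.
  have := tri y; rewrite ler_norml => /andP[h1 h2].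
  have Gy := G0 y.
  have : G y * Num.max 0 (1 - dist x y / r) <=
    G y * Num.max 0 (1 - dist x' y / r) + G y * (dist x x' / r).
    by rewrite -mulrDr ler_wpM2l//; lra.
  have : G y * (dist x x' / r) <= M x * (dist x x' / r) by rewrite ler_wpM2r.
  by rewrite [M x * _]mulrC; lra.
Qed.

End sup_convolution.

(** Continuity and openness refer to the bare distance, as [T] is only a measurable type;
    [dist_openP] translates to the topology of [Z]. *)
Definition dist_continuous (R : realType) T (dist : T -> T -> R) (f : T -> R) :=
  forall x e, 0 < e -> exists2 dl, 0 < dl & forall y, dist x y < dl -> `|f x - f y| < e.

Definition dist_open (R : realType) T (dist : T -> T -> R) (U : set T) :=
  forall x, U x -> exists2 e, 0 < e & mball dist x e `<=` U.

Lemma dist_continuousB (R : realType) T (dist : T -> T -> R) (f g : T -> R) :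
  dist_continuous dist f -> dist_continuous dist g ->
  dist_continuous dist (fun x => f x - g x).
Proof.
move=> cf cg x e e0; have e20 : 0 < e / 2 by lra.
have [d1 d10 h1] := cf x _ e20; have [d2 d20 h2] := cg x _ e20.
exists (Num.min d1 d2); first by rewrite lt_min d10.
move=> y; rewrite lt_min => /andP[/h1 {}h1 /h2 {}h2].
have -> : f x - g x - (f y - g y) = (f x - f y) - (g x - g y) by ring.
by apply: le_lt_trans (ler_normB _ _) _; lra.
Qed.

Lemma dist_continuous_open (R : realType) T (dist : T -> T -> R) (f : T -> R) t :
  dist_continuous dist f -> dist_open dist [set x | t < f x].
Proof.
move=> cf x /= tx; have tx0 : 0 < f x - t by rewrite subr_gt0.
have [dl dl0 h] := cf x _ tx0.
by exists dl => // y /h /=; rewrite ltr_norml => /andP[_]; lra.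
Qed.

Lemma dist_continuous_open_norm (R : realType) T (dist : T -> T -> R) (f : T -> R) t :
  dist_continuous dist f -> dist_open dist [set x | t < `|f x|].
Proof.
move=> cf; apply: dist_continuous_open => x e /(cf x)[dl dl0 h]; exists dl => // y /h.
by apply: le_lt_trans; exact: ler_dist_dist.
Qed.

Lemma lipschitz_dist_continuous (R : realType) T (dist : T -> T -> R) (f : T -> R) r
    (M : T -> R) :
  0 < r -> (forall x y, 0 <= dist x y) -> (forall x, 0 <= M x) ->
  (forall x y, dist x y < r -> `|f x - f y| <= dist x y / r * M x) ->
  dist_continuous dist f.
Proof.
move=> r0 d0 M0 fM x e e0; have Mx1 : 0 < M x + 1 by have := M0 x; lra.
exists (Num.min r (e * r / (M x + 1))).
  by rewrite lt_min r0 divr_gt0// mulr_gt0.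
move=> y; rewrite lt_min => /andP[/fM h]; rewrite ltr_pdivlMr// => h2.
apply: (le_lt_trans h); rewrite mulrAC ltr_pdivrMr//.
by apply: le_lt_trans h2; rewrite mulrDr mulr1 lerDl.
Qed.

(** * Estimates at one scale *)

(** The oscillation is averaged before the supremum is taken: at [y] it involves the single value
    [u y], and its supremum over a ball is not controlled by integrals. The mean over B(y, r) is
    controlled by the mean over a larger ball around any nearby [x]. *)
Definition osc_sup d (T : measurableType d) (R : realType)
    (mu : {sigma_finite_measure set T -> \bar R}) (dist : T -> T -> R) (p : R)
    (u : T -> R) (r : R) : T -> R :=
  sup_convolution dist r
    (fun y => fine (mean mu dist r (osc mu dist p u (2 * r)) y) `^ p^-1).

Definition scale_defect d (T : measurableType d) (R : realType)
    (mu : {sigma_finite_measure set T -> \bar R}) (dist : T -> T -> R) (p : R)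
    (u : T -> R) (r : R) x : R :=
  `|smooth_mean mu dist u r x - u x| + osc_sup mu dist p u r x.

(** The majorant b for [scale_defect]: up to constants, the first term bounds the p-th power of |u_k
    - u|, the second that of the Lipschitz majorant. *)
Definition osc_total d (T : measurableType d) (R : realType)
    (mu : {sigma_finite_measure set T -> \bar R}) (dist : T -> T -> R) (p : R)
    (u : T -> R) (r : R) x : \bar R :=
  (osc mu dist p u (2 * r)%R x +
   mean mu dist (4 * r)%R (osc mu dist p u (2 * r)%R) x)%E.

(** [16 * A ^+ 5] exceeds both [4 * A ^+ 2 + A ^+ 3], which bounds the size of the defect, and
    [12 * A ^+ 5 + A ^+ 3], which bounds its Lipschitz part; the power of 2 comes from
    [powRD_le]. *)
Definition defect_const (R : realType) (A p : R) : R :=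
  2 `^ p * (16 * A ^+ 5) `^ p.

Section one_scale.
Context d (T : measurableType d) (R : realType)
  (mu : {sigma_finite_measure set T -> \bar R}) (dist : T -> T -> R) (A : R).
Hypothesis H : doubling_space mu dist A.
Variables (p : R) (u : T -> R).
Hypotheses (p1 : 1 <= p) (mu_u : measurable_fun setT u).
Hypothesis u_loc : forall x r, 0 < r ->
  (\int[mu]_(y in mball dist x r) (`|u y| `^ p)%:E < +oo)%E.

Local Notation B := (mball dist).
Local Notation vol := (vol mu dist).
Local Notation ker := (ball_kernel mu dist).
Local Notation mean := (mean mu dist).
Local Notation osc := (osc mu dist p u).
Local Notation smooth := (smooth_mean mu dist u).
Local Notation diff c := (fun z => (`|u z - c| `^ p)%:E).

Let A1 : 1 <= A. Proof. exact: doubling_ge1 H. Qed.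
Let A0 : 0 <= A. Proof. exact: le_trans ler01 A1. Qed.
Let A0' : 0 < A. Proof. exact: lt_le_trans ltr01 A1. Qed.
Let p0 : 0 < p. Proof. exact: lt_le_trans ltr01 p1. Qed.
Let p0' : 0 <= p. Proof. exact: ltW. Qed.
Let pV0 : 0 <= p^-1. Proof. by rewrite invr_ge0. Qed.

Let powV_le (a : R) : 1 <= a -> a `^ p^-1 <= a.
Proof. by move=> a1; apply: ler1_powR => //; rewrite invf_le1. Qed.

Lemma measurable_diff c : measurable_fun setT (fun z => `|u z - c| `^ p).
Proof.
apply: (measurableT_comp (measurable_powR p)).
apply: (measurableT_comp (@normr_measurable R setT)).
by apply: measurable_funB => //; exact: measurable_cst.
Qed.

Lemma mean_lty s (f : T -> \bar R) x : 0 < s -> measurable_fun setT f ->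
  (forall y, 0 <= f y)%E -> (\int[mu]_y f y < +oo)%E -> (mean s f x < +oo)%E.
Proof.
move=> s0 mf f0 fi.
have v0 : 0 <= (vol x s)^-1 by rewrite invr_ge0 fine_ge0.
apply: (@le_lt_trans _ _ (\int[mu]_y (((vol x s)^-1)%:E * f y))%E).
  apply: ge0_le_integralT => y; first by rewrite mule_ge0// lee_fin ker_ge0.
  by rewrite lee_wpmul2r// lee_fin /ball_kernel; case: ifP.
rewrite ge0_integralZl// lte_mul_pinfty//.
Qed.

Lemma mean_diff_lty s x c : 0 < s -> (mean s (diff c) x < +oo)%E.
Proof.
move=> s0; pose f := (fun z => (`|u z| `^ p)%:E) \_ (B x s).
have v0 : 0 <= (vol x s)^-1 by rewrite invr_ge0 fine_ge0.
have f0 z : (0 <= f z)%E.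
  by apply: erestrict_ge0 => y _; rewrite lee_fin powR_ge0.
have mf : measurable_fun setT f.
  apply/(measurable_restrictT _ (measurable_mball H _ _)).
  apply: measurable_funTS; apply/measurable_EFinP.
  apply: (measurableT_comp (measurable_powR p)).
  exact: (measurableT_comp (@normr_measurable R setT)).
have fi : (\int[mu]_z f z < +oo)%E by rewrite -integral_mkcond u_loc.
have mk : measurable_fun setT (fun y => (ker s x y)%:E).
  by apply/measurable_EFinP; exact: measurable_ker_r H _ _.
apply: (@le_lt_trans _ _ (\int[mu]_z ((2 `^ p * (vol x s)^-1)%:E * f z +
    (2 `^ p * `|c| `^ p)%:E * (ker s x z)%:E))%E).
  apply: ge0_le_integralT => z; first by rewrite mule_ge0// lee_fin ?ker_ge0 ?powR_ge0.
  rewrite /f /patch /ball_kernel.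
  have [xz|xz] := ltP (dist x z) s.
    rewrite mem_set//= -!EFinM -EFinD lee_fin.
    have -> : 2 `^ p * (vol x s)^-1 * `|u z| `^ p + 2 `^ p * `|c| `^ p * (vol x s)^-1 =
      (vol x s)^-1 * (2 `^ p * (`|u z| `^ p + `|c| `^ p)) by ring.
    rewrite ler_wpM2l//.
    apply: le_trans (powRD_le _ _ _) => //.
    by apply: ler_powR2r => //; exact: ler_normB.
  by rewrite memNset /mball/= ?mule0 ?mul0e ?adde0//; apply/negP; rewrite -leNgt.
have c0 : 0 <= 2 `^ p * `|c| `^ p by rewrite mulr_ge0 ?powR_ge0.
have c1 : 0 <= 2 `^ p * (vol x s)^-1 by rewrite mulr_ge0 ?powR_ge0.
rewrite ge0_integralD//; last 4 first.
- by move=> z _; rewrite mule_ge0.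
- by apply: measurable_funeM.
- by move=> z _; rewrite mule_ge0// lee_fin ker_ge0.
- by apply: measurable_funeM.
rewrite ge0_integralZl// ge0_integralZl//; last by move=> z _; rewrite lee_fin ker_ge0.
by rewrite (int_kerr H)// mule1 lte_add_pinfty ?ltry// lte_mul_pinfty.
Qed.

Lemma mean_diff_ge0 s x c : (0 <= mean s (diff c) x)%E.
Proof. by apply: mean_ge0 => y; rewrite lee_fin powR_ge0. Qed.

Lemma mean_diffE s x c : 0 < s -> mean s (diff c) x = (fine (mean s (diff c) x))%:E.
Proof. by move=> s0; rewrite fineK// ge0_fin_numE ?mean_diff_ge0 ?mean_diff_lty. Qed.

Lemma osc_fin s x : 0 < s -> osc s x = (fine (osc s x))%:E.
Proof. by move=> s0; exact: mean_diffE. Qed.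

(** One estimate for two kernels: a smooth kernel, of integral 1, gives the distance of the smooth
    mean from [c]; the difference of two smooth kernels, of integral 0, gives the variation of the
    smooth mean with its centre. *)
Lemma kernel_mean_le (k : T -> R) K s x c : 0 < s -> 0 <= K ->
  measurable_fun setT k -> (forall z, `|k z| <= K * ker s x z) ->
  `|\int[mu]_z (k z * u z) - c * \int[mu]_z k z| <=
    2 * K * fine (mean s (diff c) x) `^ p^-1 /\
  mu.-integrable setT (EFin \o (fun z => k z * u z)).
Proof.
move=> s0 K0 mk kK; have [ik _] := integrable_le_ker H s0 K0 mk kK.
set I := fine _.
have I0 : 0 <= I by rewrite fine_ge0// mean_diff_ge0.
have mkr : measurable_fun setT (ker s x) by exact: measurable_ker_r H _ _.
have mdc : measurable_fun setT (fun z => `|u z - c|).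
  apply: (measurableT_comp (@normr_measurable R setT)).
  by apply: measurable_funB => //; exact: measurable_cst.
have J : (\int[mu]_z (ker s x z * `|u z - c|)%:E <= (2 * I `^ p^-1)%:E)%E.
  apply: (weighted_mean_powR_le p1) => //.
  - exact: powR_ge0.
  - by move=> z; exact: ker_ge0.
  - by rewrite (int_kerr H).
  - by rewrite powR_invK// -mean_diffE.
have J2 : (\int[mu]_z `|(k z * (u z - c))%:E| <= (2 * K * I `^ p^-1)%:E)%E.
  apply: (@le_trans _ _ (\int[mu]_z (K%:E * (ker s x z * `|u z - c|)%:E))%E).
    apply: ge0_le_integralT => z //=.
    by rewrite -EFinM lee_fin normrM mulrA ler_wpM2r.
  rewrite ge0_integralZl//; last 2 first.
  - by apply/measurable_EFinP; exact: measurable_funM.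
  - by move=> z _; rewrite lee_fin mulr_ge0// ker_ge0.
  apply: (le_trans (lee_wpmul2l _ J)); first by rewrite lee_fin.
  by rewrite -EFinM lee_fin mulrA [K * 2]mulrC.
have ikd : mu.-integrable setT (EFin \o (fun z => k z * (u z - c))).
  apply/integrableP; split.
    apply/measurable_EFinP; apply: measurable_funM => //.
    by apply: measurable_funB => //; exact: measurable_cst.
  by apply: le_lt_trans J2 _; rewrite ltry.
have ick : mu.-integrable setT (EFin \o (fun z => c * k z)).
  exact: (integrableZl measurableT c ik).
have kuE : (fun z => k z * u z) = (fun z => k z * (u z - c) + c * k z).
  by apply/funext => z; ring.
split.
  rewrite kuE RintegralD// RintegralZl// addrK.
  apply: le_trans (le_normr_Rintegral measurableT ikd) _.
  rewrite -lee_fin /Rintegral fineK//; apply/integral_fune_fin_num => //.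
  exact: integrable_norm.
rewrite kuE; exact: (integrableD measurableT ikd ick).
Qed.

Lemma smooth_mean_diff_le r x c : 0 < r ->
  `|smooth r x - c| <= 4 * A * fine (mean r (diff c) x) `^ p^-1.
Proof.
move=> r0; have := @kernel_mean_le (smooth_kernel mu dist r x) (2 * A) r x c r0.
rewrite (int_psi H)// mulr1 => h; have [||z|{}h _] := h; last first.
- by apply: (le_trans h); rewrite mulrA; have -> : 2 * 2 = 4 :> R by ring.
- by rewrite ger0_norm ?(psi_ge0 H)// (psi_le_ker H).
- exact: measurable_psi H _ _.
- by rewrite mulr_ge0.
Qed.

Variable r : R.
Hypotheses (r0 : 0 < r) (osc_int : (\int[mu]_x osc (2 * r)%R x < +oo)%E).

Local Notation a := (osc (2 * r)).
Local Notation h := (mean (4 * r) a).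

Let r20 : 0 < 2 * r. Proof. by rewrite mulr_gt0. Qed.
Let r40 : 0 < 4 * r. Proof. by rewrite mulr_gt0. Qed.

Let a0 x : (0 <= a x)%E. Proof. exact: osc_ge0. Qed.
Let ma : measurable_fun setT a. Proof. exact: (measurable_osc H p (2 * r) mu_u). Qed.
Let h0 x : (0 <= h x)%E. Proof. exact: mean_ge0. Qed.

Lemma mean_osc_fin s x : 0 < s -> mean s a x = (fine (mean s a x))%:E.
Proof. by move=> s0; rewrite fineK// ge0_fin_numE ?mean_ge0// mean_lty. Qed.

Let b x : R := fine (a x) + fine (h x).
Let t x : R := b x `^ p^-1.

Lemma osc_totalE x : osc_total mu dist p u r x = (b x)%:E.
Proof. by rewrite /osc_total osc_fin// mean_osc_fin. Qed.

Let b0 x : 0 <= b x. Proof. by rewrite addr_ge0 ?fine_ge0. Qed.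
Let t0 x : 0 <= t x. Proof. exact: powR_ge0. Qed.
Let tp x : t x `^ p = b x. Proof. exact: powR_invK. Qed.

Let a_le x n : (A ^+ n * fine (a x)) `^ p^-1 <= A ^+ n * t x.
Proof.
rewrite powRM ?exprn_ge0 ?fine_ge0//; apply: ler_pM; rewrite ?powR_ge0//.
  by apply: powV_le; rewrite exprn_ege1.
by apply: ler_powR2r; rewrite ?fine_ge0// lerDl fine_ge0.
Qed.

Let h_le x n : (A ^+ n * fine (h x)) `^ p^-1 <= A ^+ n * t x.
Proof.
rewrite powRM ?exprn_ge0 ?fine_ge0//; apply: ler_pM; rewrite ?powR_ge0//.
  by apply: powV_le; rewrite exprn_ege1.
by apply: ler_powR2r; rewrite ?fine_ge0// lerDr fine_ge0.
Qed.

Lemma mean_le_exp n s s' x x' f : 0 < s -> 0 < s' -> measurable_fun setT f ->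
  (forall y, 0 <= f y)%E ->
  (forall y, dist x y < s -> dist x' y < s') -> dist x x' + s' <= 2 ^+ n * s ->
  (mean s f x <= (A ^+ n)%:E * mean s' f x')%E.
Proof.
move=> s0 s0' mf f0 h1 h2.
rewrite -ge0_integralZl//; last 3 first.
- apply: emeasurable_funM => //; apply/measurable_EFinP; exact: measurable_ker_r H _ _.
- by move=> y _; rewrite mule_ge0// lee_fin ker_ge0.
- by rewrite lee_fin exprn_ge0.
apply: ge0_le_integralT => y; first by rewrite mule_ge0// lee_fin ker_ge0.
rewrite muleA -EFinM lee_wpmul2r// lee_fin.
by apply: (ker_le_exp H) => //; exact: h1.
Qed.

Let smooth_mean_dist_le x : `|smooth r x - u x| <= 4 * A ^+ 2 * t x.
Proof.
apply: le_trans (smooth_mean_diff_le x (u x) r0) _.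
rewrite expr2 mulrA -[X in _ <= X]mulrA ler_wpM2l ?mulr_ge0//.
apply: (le_trans _ (a_le x 1)); apply: ler_powR2r => //.
  by rewrite fine_ge0// mean_diff_ge0.
rewrite -lee_fin -mean_diffE// EFinM -osc_fin//.
apply: mean_le_exp => //.
- by apply/measurable_EFinP; exact: measurable_diff.
- by move=> y xy; have := r0; lra.
- by rewrite (dist_xx H) add0r expr1.
Qed.

Let smooth_mean_lipschitz x x' : dist x x' < r ->
  `|smooth r x - smooth r x'| <= 12 * A ^+ 5 * (dist x x' / r) * t x.
Proof.
move=> xx'; have dr0 : 0 <= dist x x' / r by rewrite divr_ge0 ?(dist_ge0 H)// ltW.
pose k z := smooth_kernel mu dist r x z - smooth_kernel mu dist r x' z.
have K0 : 0 <= (2 * A ^+ 2 + 4 * A ^+ 5) * (dist x x' / r).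
  by rewrite mulr_ge0// addr_ge0 ?mulr_ge0 ?exprn_ge0.
have mk : measurable_fun setT k.
  by apply: measurable_funB; exact: measurable_psi H _ _.
have [hk _] := @kernel_mean_le k _ (2 * r) x (u x) r20 K0 mk
  (fun z => psi_lipschitz H z r0 xx').
have ipsi y : mu.-integrable setT (EFin \o smooth_kernel mu dist r y).
  have [||z|//] := @integrable_le_ker _ T R mu dist A H (smooth_kernel mu dist r y) (2 * A) r y r0.
  - by rewrite mulr_ge0.
  - exact: measurable_psi H _ _.
  - by rewrite ger0_norm ?(psi_ge0 H)// (psi_le_ker H).
have ipsiu y : mu.-integrable setT (EFin \o (fun z => smooth_kernel mu dist r y z * u z)).
  have [||z|//] := @kernel_mean_le (smooth_kernel mu dist r y) (2 * A) r y 0 r0.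
  - by rewrite mulr_ge0.
  - exact: measurable_psi H _ _.
  - by rewrite ger0_norm ?(psi_ge0 H)// (psi_le_ker H).
have ik : \int[mu]_z k z = 0 by rewrite RintegralB// !(int_psi H)// subrr.
have iku : \int[mu]_z (k z * u z) = smooth r x - smooth r x'.
  rewrite -RintegralB//; apply: eq_Rintegral => z _; by rewrite mulrBl.
rewrite ik mulr0 subr0 iku in hk; apply: (le_trans hk).
have -> : 12 * A ^+ 5 * (dist x x' / r) * t x =
  2 * (6 * A ^+ 5 * (dist x x' / r)) * t x by ring.
apply: ler_pM; [exact: mulr_ge0|exact: powR_ge0| |].
  rewrite ler_pM2l// ler_wpM2r//.
  have : A ^+ 2 <= A ^+ 5 by rewrite ler_weXn2l.
  have -> : 6 * A ^+ 5 = 2 * A ^+ 5 + 4 * A ^+ 5 by ring.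
  by move=> h2; rewrite lerD2r ler_pM2l.
by have := a_le x 0; rewrite expr0 !mul1r.
Qed.

Let G y : R := fine (mean r a y) `^ p^-1.

Let G0 y : 0 <= G y. Proof. exact: powR_ge0. Qed.

(** B(y, r) lies in B(x, 4r), the ball of the mean in [osc_total]; the exponent 3 comes from
    [2 * r + 4 * r <= 8 * r]. *)
Let GM x y : dist x y < 2 * r -> G y <= A ^+ 3 * t x.
Proof.
move=> xy; apply: (le_trans _ (h_le x 3)); apply: ler_powR2r => //.
  by rewrite fine_ge0// mean_ge0.
rewrite -lee_fin -mean_osc_fin// EFinM -mean_osc_fin//.
have r0' := r0; apply: mean_le_exp => //.
- by move=> z yz; have := dist_triangle H y x z; lra.
- by rewrite (dist_sym H y x) !exprS expr0; lra.
Qed.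

Lemma osc_sup_ge x : fine (mean r a x) `^ p^-1 <= osc_sup mu dist p u r x.
Proof. exact: (sup_convolution_ge H r0 G0 GM). Qed.

Let osc_sup_le x : osc_sup mu dist p u r x <= A ^+ 3 * t x.
Proof. exact: (sup_convolution_le H r0 G0 GM). Qed.

Let osc_sup_lipschitz x x' : dist x x' < r ->
  `|osc_sup mu dist p u r x - osc_sup mu dist p u r x'| <=
    dist x x' / r * (A ^+ 3 * t x).
Proof. exact: (sup_convolution_lipschitz H r0 G0 GM). Qed.

Lemma osc_sup_ge0 x : 0 <= osc_sup mu dist p u r x.
Proof. exact: le_trans (G0 x) (osc_sup_ge x). Qed.

Lemma smooth_mean_continuous : dist_continuous dist (smooth r).
Proof.
apply: (@lipschitz_dist_continuous _ _ _ _ r (fun x => 12 * A ^+ 5 * t x)) => //.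
- exact: dist_ge0 H.
- by move=> x; rewrite !mulr_ge0 ?exprn_ge0.
- by move=> x y /smooth_mean_lipschitz; rewrite mulrAC mulrC.
Qed.

Lemma osc_sup_continuous : dist_continuous dist (osc_sup mu dist p u r).
Proof.
apply: (@lipschitz_dist_continuous _ _ _ _ r (fun x => A ^+ 3 * t x)) => //.
- exact: dist_ge0 H.
- by move=> x; rewrite !mulr_ge0 ?exprn_ge0.
Qed.

Local Notation D := (defect_const A p).

Let A5 : 1 <= A ^+ 5. Proof. by rewrite exprn_ege1. Qed.
Let A25 : A ^+ 2 <= A ^+ 5. Proof. by rewrite ler_weXn2l. Qed.
Let A35 : A ^+ 3 <= A ^+ 5. Proof. by rewrite ler_weXn2l. Qed.

Lemma scale_defect_ge0 x : 0 <= scale_defect mu dist p u r x.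
Proof. by rewrite addr_ge0// osc_sup_ge0. Qed.

Let defect_le x : scale_defect mu dist p u r x <= 16 * A ^+ 5 * t x.
Proof.
apply: (@le_trans _ _ (4 * A ^+ 2 * t x + A ^+ 3 * t x)).
  by apply: lerD; [exact: smooth_mean_dist_le|exact: osc_sup_le].
rewrite -mulrDl ler_wpM2r//.
by have := A25; have := A35; have := A5; move: (A ^+ 2) (A ^+ 3) (A ^+ 5) => ? ? ?; lra.
Qed.

Let D1 : (16 * A ^+ 5) `^ p <= D.
Proof.
rewrite ler_peMl ?powR_ge0//.
by rewrite -[leLHS](powRr0 2); apply: ler_powR => //; lra.
Qed.

Let defect_powR x : scale_defect mu dist p u r x `^ p <= (16 * A ^+ 5) `^ p * b x.
Proof.
rewrite -tp -powRM ?mulr_ge0 ?exprn_ge0//.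
by apply: ler_powR2r => //; exact: scale_defect_ge0.
Qed.

Lemma scale_defect_powR_le x :
  ((scale_defect mu dist p u r x `^ p)%:E <= D%:E * osc_total mu dist p u r x)%E.
Proof.
rewrite osc_totalE -EFinM lee_fin; apply: (le_trans (defect_powR x)).
by rewrite ler_wpM2r.
Qed.

(** At distance at least [r] the sizes of the defect at both points suffice. Below [r] the smooth
    mean and the majorant are Lipschitz, and only |u x - u y| remains, which this scale does not
    control. *)
Lemma scale_defect_diff_le x y :
  ((`|scale_defect mu dist p u r x - scale_defect mu dist p u r y| `^ p)%:E <=
  D%:E * ((Num.min 1 (dist x y / r) `^ p)%R%:E *
      (osc_total mu dist p u r x + osc_total mu dist p u r y) +
    ((if dist x y < r then `|u x - u y| `^ p else 0)%R)%:E))%E.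
Proof.
rewrite !osc_totalE -EFinD -EFinM lee_fin.
have f0 z := scale_defect_ge0 z.
have D0 : 0 <= D by rewrite mulr_ge0 ?powR_ge0.
have K0 : 0 <= 16 * A ^+ 5 by rewrite mulr_ge0// exprn_ge0.
case: ltP => xy; last first.
  rewrite min_l; last by rewrite ler_pdivlMr// mul1r.
  rewrite powR1 mul1r addr0.
  wlog : x y xy / scale_defect mu dist p u r y <= scale_defect mu dist p u r x.
    move=> hw; have [|/ltW] := leP (scale_defect mu dist p u r y) (scale_defect mu dist p u r x).
      exact: hw.
    by rewrite distrC addrC; apply: hw; rewrite (dist_sym H).
  move=> yx; apply: (@le_trans _ _ (scale_defect mu dist p u r x `^ p)).
    apply: ler_powR2r => //; rewrite ger0_norm ?subr_ge0// gerBl//.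
  apply: (le_trans (defect_powR x)).
  by apply: ler_pM; rewrite ?powR_ge0// lerDl.
have dr0 : 0 <= dist x y / r by rewrite divr_ge0 ?(dist_ge0 H)// ltW.
rewrite min_r; last by rewrite ler_pdivrMr// mul1r ltW.
apply: (@le_trans _ _ ((16 * A ^+ 5 * (dist x y / r) * t x + `|u x - u y|) `^ p)).
  apply: ler_powR2r => //.
  have h1 := smooth_mean_lipschitz xy; have h2 := osc_sup_lipschitz xy.
  rewrite /scale_defect.
  set ux := smooth r x in h1 *; set uy := smooth r y in h1 *.
  set wx := osc_sup _ _ _ _ _ x in h2 *; set wy := osc_sup _ _ _ _ _ y in h2 *.
  have h3 : `| `|ux - u x| - `|uy - u y| | <= `|ux - uy| + `|u x - u y|.
    apply: le_trans (ler_dist_dist _ _) _.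
    have -> : ux - u x - (uy - u y) = (ux - uy) - (u x - u y) by ring.
    exact: ler_normB.
  have -> : `|ux - u x| + wx - (`|uy - u y| + wy) =
    (`|ux - u x| - `|uy - u y|) + (wx - wy) by ring.
  apply: le_trans (ler_normD _ _) _.
  have h4 : A ^+ 3 * ((dist x y / r) * t x) <= A ^+ 5 * ((dist x y / r) * t x).
    by apply: ler_wpM2r => //; exact: mulr_ge0.
  have h5 : 0 <= A ^+ 5 * ((dist x y / r) * t x).
    by apply: mulr_ge0; [rewrite exprn_ge0|exact: mulr_ge0].
  have e1 : dist x y / r * (A ^+ 3 * t x) = A ^+ 3 * ((dist x y / r) * t x) by ring.
  have e2 : 12 * A ^+ 5 * (dist x y / r) * t x = 12 * (A ^+ 5 * ((dist x y / r) * t x)) by ring.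
  have e3 : 16 * A ^+ 5 * (dist x y / r) * t x = 16 * (A ^+ 5 * ((dist x y / r) * t x)) by ring.
  move: h1 h2 h3 h4 h5; rewrite e1 e2 e3.
  by move: (A ^+ 3 * _) (A ^+ 5 * _) => ? ?; lra.
have Kd0 : 0 <= 16 * A ^+ 5 * (dist x y / r) by exact: mulr_ge0.
apply: le_trans (powRD_le _ _ _) _ => //; first exact: mulr_ge0.
rewrite powRM// powRM// tp.
have K1 : 1 <= (16 * A ^+ 5) `^ p.
  apply: (@le_trans _ _ (1 `^ p)); first by rewrite powR1.
  apply: ler_powR2r => //.
  by have := A5; move: (A ^+ 5) => ?; lra.
rewrite /defect_const -[leRHS]mulrA ler_wpM2l ?powR_ge0// [leRHS]mulrDr; apply: lerD; last first.
  by rewrite ler_peMl// powR_ge0.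
rewrite -mulrA ler_wpM2l ?powR_ge0// ler_wpM2l ?powR_ge0//.
by rewrite lerDl.
Qed.

(** For [y] in B(x, r), [smooth_mean_diff_le] is used with c = u y; its mean over B(x, r) is at most
    [A ^+ 2] times the one over B(y, 2r). This enlargement is why oscillations are taken over balls
    of radius [2 * r]. Averaging over [y] concludes. *)
Lemma mean_diff_smooth_le x :
  (mean r (diff (smooth r x)) x <= ((4 * A) `^ p * A ^+ 2)%:E * mean r a x)%E.
Proof.
have K0 : 0 <= (4 * A) `^ p * A ^+ 2 by rewrite mulr_ge0 ?powR_ge0 ?exprn_ge0.
rewrite -ge0_integralZl//; last 2 first.
- apply: emeasurable_funM => //; apply/measurable_EFinP; exact: measurable_ker_r H _ _.
- by move=> y _; rewrite mule_ge0// lee_fin ker_ge0.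
apply: ge0_le_integralT => y; first by rewrite mule_ge0// lee_fin ?ker_ge0 ?powR_ge0.
rewrite /ball_kernel; case: ltP => xy; last by rewrite !mul0e mule0.
rewrite muleCA lee_wpmul2l ?lee_fin ?invr_ge0 ?fine_ge0//.
rewrite osc_fin// -EFinM lee_fin distrC -mulrA.
have K1 : 0 <= A ^+ 2 * fine (a y) by rewrite mulr_ge0 ?exprn_ge0 ?fine_ge0.
rewrite -[X in _ * X](powR_invK K1 p0) -powRM ?powR_ge0 ?mulr_ge0//.
apply: ler_powR2r => //; apply: le_trans (smooth_mean_diff_le x (u y) r0) _.
rewrite ler_wpM2l ?mulr_ge0//; apply: ler_powR2r => //.
  by rewrite fine_ge0// mean_diff_ge0.
rewrite -lee_fin -mean_diffE// EFinM -osc_fin//.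
have r0' := r0; apply: mean_le_exp => //.
- by apply/measurable_EFinP; exact: measurable_diff.
- by move=> z xz; have := dist_triangle H x y z; rewrite (dist_sym H y x); lra.
- by rewrite expr2; lra.
Qed.

End one_scale.

(** * All scales *)

(** Raising [g] to [+oo] on a measurable null set containing the exceptional points makes the bound
    pointwise and leaves the integral of [g] unchanged. *)
Lemma ae_le_integralT d (T : measurableType d) (R : realType)
    (mu : {measure set T -> \bar R}) (f g : T -> \bar R) :
  (forall x, 0 <= f x)%E -> (forall x, 0 <= g x)%E -> measurable_fun setT g ->
  {ae mu, forall x, (f x <= g x)%E} -> (\int[mu]_x f x <= \int[mu]_x g x)%E.
Proof.
move=> f0 g0 mg [N [mN N0 fgN]].
pose h : T -> \bar R := cst +oo%E \_ N.
have h0 x : (0 <= h x)%E by apply: erestrict_ge0 => y _; exact: leey.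
have mh : measurable_fun setT h.
  by apply/(measurable_restrictT _ mN); exact: measurable_cst.
have ih : (\int[mu]_x h x = 0)%E by rewrite -integral_mkcond integral_cst// N0 mule0.
rewrite -[leRHS]adde0 -ih -ge0_integralD//.
apply: ge0_le_integralT => // x.
have [xN|xN] := pselect (N x).
  by rewrite /h patchE mem_set// addey ?leey// gt_eqF// (lt_le_trans _ (g0 x))// ltNyr.
rewrite /h patchE memNset// adde0.
by apply: contrapT => /fgN.
Qed.

Lemma ler_dist_sups (R : realType) (f g : nat -> R) K m :
  has_ubound (range f) -> has_ubound (range g) ->
  (forall k, (K <= k)%N -> `|f k - g k| <= m) -> `|sups f K - sups g K| <= m.
Proof.
wlog : f g / sups g K <= sups f K.
  move=> hw uf ug fg; have [|/ltW] := leP (sups g K) (sups f K).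
    by move=> h; exact: hw.
  by move=> h; rewrite distrC; apply: hw => // k /fg; rewrite distrC.
move=> gf _ [M ugM] fg; rewrite ger0_norm ?subr_ge0// lerBlDr.
apply: ge_sup; first by exists (f K); exists K => /=.
move=> _ [k /= Kk <-].
have : g k <= sups g K.
  by apply: ub_le_sup; [exists M => _ [j _ <-]; apply: ugM; exists j|exists k].
by have := fg k Kk; rewrite ler_norml; lra.
Qed.

Lemma normr_minr_le (R : realType) (a b : R) :
  `|Num.min 1 a - Num.min 1 b| <= `|a - b|.
Proof.
wlog ba : a b / b <= a.
  move=> hw; have [h|/ltW h] := leP b a; first exact: hw.
  by rewrite distrC [leRHS]distrC; exact: hw.
rewrite [leRHS]ger0_norm ?subr_ge0//.
by case: (leP 1 a) => h1; case: (leP 1 b) => h2; rewrite ger0_norm; lra.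
Qed.

Lemma measurable_dist_continuous d (T : measurableType d) (R : realType)
    (mu : {sigma_finite_measure set T -> \bar R}) (dist : T -> T -> R) (A : R)
    (f : T -> R) :
  doubling_space mu dist A -> dist_continuous dist f -> measurable_fun setT f.
Proof.
move=> H cf.
apply: (measurability _ (RGenOInfty.measurableE R)) => _ [_ [t ->] <-].
rewrite setTI [X in measurable X](_ : _ = [set x | t < f x]).
  by apply: (open_measurable_dist H); exact: dist_continuous_open.
by apply/seteqP; split => x /=; rewrite in_itv/= andbT.
Qed.

Section multiscale.
Context d (T : measurableType d) (R : realType)
  (mu : {sigma_finite_measure set T -> \bar R}) (dist : T -> T -> R) (A : R).
Hypothesis H : doubling_space mu dist A.
Variables (p q : R) (u : T -> R).
Hypotheses (p1 : 1 <= p) (q0 : 0 < q) (qp : q < p) (mu_u : measurable_fun setT u).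
Hypothesis u_loc : forall x r, 0 < r ->
  (\int[mu]_(y in mball dist x r) (`|u y| `^ p)%:E < +oo)%E.
Hypothesis u_energy : (energy mu dist p q u < +oo)%E.

Local Notation B := (mball dist).
Local Notation vol := (vol mu dist).
Local Notation ker := (ball_kernel mu dist).
Local Notation mean := (mean mu dist).
Local Notation osc := (osc mu dist p u).
Local Notation smooth := (smooth_mean mu dist u).
Local Notation rad := (radius R).
Local Notation energy := (energy mu dist p q).
Local Notation defect := (scale_defect mu dist p u).
Local Notation total := (osc_total mu dist p u).
Local Notation D := (defect_const A p).

Let A1 : 1 <= A. Proof. exact: doubling_ge1 H. Qed.
Let A0 : 0 <= A. Proof. exact: le_trans ler01 A1. Qed.
Let p0 : 0 < p. Proof. exact: lt_le_trans ltr01 p1. Qed.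
Let p0' : 0 <= p. Proof. exact: ltW. Qed.
Let D0 : 0 <= D. Proof. by rewrite mulr_ge0 ?powR_ge0. Qed.
Let rad0 k : 0 < rad k. Proof. exact: radius_gt0. Qed.

Let e k : \bar R := (((rad k `^ q)^-1)%:E * \int[mu]_x osc (2 * rad k)%R x)%E.

Let iosc0 k : (0 <= \int[mu]_x osc (2 * rad k)%R x)%E.
Proof. by apply: integral_ge0 => x _; exact: osc_ge0. Qed.

Let e0 k : (0 <= e k)%E.
Proof. by rewrite mule_ge0// lee_fin invr_ge0 powR_ge0. Qed.

Let e_sum : (\sum_(k <oo) e k < +oo)%E.
Proof.
have [C C0 hC] := energy_ge H q0 qp mu_u.
have : (C%:E * \sum_(k <oo) e k < +oo)%E.
  apply: le_lt_trans u_energy; apply: le_trans hC.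
  rewrite -nneseriesZl//; apply: lee_nneseries => [k _ _|k _].
    by rewrite mule_ge0// lee_fin ltW.
  by rewrite muleA -EFinM.
have S0 : (0 <= \sum_(k <oo) e k)%E by apply: nneseries_ge0.
move: S0; case: (\sum_(k <oo) e k)%E => [s _ _|_|//]; first by rewrite ltry.
by rewrite gt0_muley ?lte_fin.
Qed.

Let rad_le1 k : rad k <= 1.
Proof. by apply: exprn_ile1; rewrite ?invr_ge0// invf_le1// ler1n. Qed.

(** Because of this, the weighted integrals [e k] also control the unweighted ones, hence the L^p
    norms. *)
Let invrad_ge1 k : 1 <= (rad k `^ q)^-1.
Proof.
rewrite invf_ge1 ?powR_gt0//; apply: (@le_trans _ _ (1 `^ q)); last by rewrite powR1.
by apply: ler_powR2r => //; exact: ltW.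
Qed.

Let iosc_le k : (\int[mu]_x osc (2 * rad k)%R x <= e k)%E.
Proof. by rewrite -[leLHS]mul1e lee_wpmul2r// lee_fin. Qed.

Let iosc k : (\int[mu]_x osc (2 * rad k)%R x < +oo)%E.
Proof.
apply: le_lt_trans (iosc_le k) _; apply: le_lt_trans e_sum.
exact: nneseries_term_le.
Qed.

Let total0 k x : (0 <= total (rad k) x)%E.
Proof. by rewrite adde_ge0 ?osc_ge0// mean_ge0// => y; exact: osc_ge0. Qed.

Let mtotal k : measurable_fun setT (total (rad k)).
Proof.
have m1 : measurable_fun setT (osc (2 * rad k)) by exact: (measurable_osc H).
apply: emeasurable_funD => //; apply: (measurable_mean H) => //.
by move=> y; exact: osc_ge0.
Qed.

Let itotal k : (\int[mu]_x total (rad k) x <= (1 + A)%:E * \int[mu]_x osc (2 * rad k)%R x)%E.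
Proof.
have m1 : measurable_fun setT (osc (2 * rad k)) by exact: (measurable_osc H).
have o0 y : (0 <= osc (2 * rad k)%R y)%E by exact: osc_ge0.
rewrite ge0_integralD//; last 2 first.
- by move=> x _; exact: mean_ge0.
- exact: (measurable_mean H).
rewrite EFinD ge0_muleDl// mul1e leeD2l//.
by apply: (int_mean_le H) => //; rewrite mulr_gt0.
Qed.

Let total_cvg x : (\sum_(k <oo) total (rad k) x < +oo)%E ->
  smooth (rad k) x @[k --> \oo] --> u x.
Proof.
move=> hx; apply/cvgrPdist_le => eps eps0.
have := @nneseries_tail_cvg R (fun k => total (rad k) x) xpredT hx (fun k _ => total0 k x).
have Deps : 0 < eps `^ p / (D + 1) by rewrite divr_gt0 ?powR_gt0// ltr_wpDl.
move/fine_cvgP => [[K1 _ hK1]] /cvgrPdist_lt /(_ _ Deps)[K2 _ hK2].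
exists (maxn K1 K2) => // k /=; rewrite geq_max => /andP[k1 k2].
have := hK2 k k2; rewrite sub0r normrN/= => h.
have tfin := hK1 k k1.
have : (total (rad k) x < (eps `^ p / (D + 1))%:E)%E.
  apply: (@le_lt_trans _ _ (\sum_(k <= i <oo) total (rad i) x)%E).
    by rewrite (nneseries_split k 1)// addn1 big_nat1 leeDl//; apply: nneseries_ge0.
  rewrite -(fineK tfin) lte_fin; apply: le_lt_trans h; exact: ler_norm.
move=> tk; rewrite distrC.
have hd := scale_defect_powR_le H p1 mu_u u_loc (rad0 k) (iosc k) x.
have h2 : `|smooth (rad k) x - u x| <= defect (rad k) x.
  by rewrite lerDl; exact: (osc_sup_ge0 H p1 mu_u (rad0 k) (iosc k)).
apply: (le_trans h2); rewrite -[eps](powR_Kinv (ltW eps0) p0).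
apply: le_powR_inv; [exact: p0| |exact: powR_ge0|].
  exact: (scale_defect_ge0 H p1 mu_u (rad0 k) (iosc k)).
rewrite -lee_fin; apply: (le_trans hd).
apply: (@le_trans _ _ (D%:E * (eps `^ p / (D + 1))%:E)%E).
  by rewrite lee_wpmul2l// ltW.
rewrite -EFinM lee_fin mulrCA ler_piMr ?powR_ge0// ler_pdivrMr ?mul1r ?lerDl//.
by rewrite ltr_wpDl.
Qed.

(** Where the smooth means diverge, [limn] is a default value; such points lie in every exceptional
    set below. *)
Definition representative x : R := limn (fun k => smooth (rad k) x).

(** The sum of the [total (rad k)] is integrable, hence finite almost everywhere, and its terms
    bound the p-th powers of |u_k - u| up to a constant. *)
Lemma ae_representative : {ae mu, forall x, u x = representative x}.
Proof.
have mS : measurable_fun setT (fun x => \sum_(k <oo) total (rad k) x)%E.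
  by apply: ge0_emeasurable_sum.
have S0 x : (0 <= \sum_(k <oo) total (rad k) x)%E by apply: nneseries_ge0.
have iS : mu.-integrable setT (fun x => \sum_(k <oo) total (rad k) x)%E.
  apply/integrableP; split => //.
  under eq_integral do rewrite gee0_abs//.
  rewrite integral_nneseries//.
  apply: (@le_lt_trans _ _ ((1 + A)%:E * \sum_(k <oo) e k)%E); last first.
    rewrite lte_mul_pinfty ?lee_fin ?addr_ge0//.
  rewrite -nneseriesZl//; apply: lee_nneseries => [k _ _|k _].
    exact: integral_ge0.
  apply: (le_trans (itotal k)).
  by rewrite lee_wpmul2l// lee_fin addr_ge0.
have := integrable_ae measurableT iS.
apply: filterS => x /(_ I); rewrite ge0_fin_numE// => /total_cvg.
by rewrite /representative => /cvg_lim <-.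
Qed.

(** * Weights, test functions and exceptional sets *)

Section weights.
Variable w : nat -> R.
Hypotheses (w_gt0 : forall k, 0 < w k)
  (w_mono : forall m n, (m <= n)%N -> w m <= w n)
  (w_infty : forall M, exists K, forall k, (K <= k)%N -> M <= w k)
  (w_sum : forall eps, 0 < eps -> exists K,
    (\sum_(k <oo) ((if (K <= k)%N then w k else 0)%:E * e k) <= eps%:E)%E).

Let lam k : R := w k `^ p^-1.
Let lam0 k : 0 < lam k. Proof. exact: powR_gt0. Qed.
Let lamp k : lam k `^ p = w k. Proof. by rewrite powR_invK// ltW. Qed.

Let lam_mono m n : (m <= n)%N -> lam m <= lam n.
Proof. by move=> mn; apply: ler_powR2r; [rewrite invr_ge0|exact: ltW|exact: w_mono]. Qed.

Let defect0 k x : 0 <= defect (rad k) x.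
Proof. exact: (scale_defect_ge0 H p1 mu_u (rad0 k) (iosc k)). Qed.

(* The truncation makes the supremum below finite; it costs nothing, since the
   capacity only asks for values at least 1. *)
Let g k x : R := Num.min 1 (lam k * defect (rad k) x).

Definition test_function K x : R := sups (fun k => g k x) K.

Let g0 k x : 0 <= g k x.
Proof. by rewrite /g le_min ler01 mulr_ge0// ltW. Qed.

Let g1 k x : g k x <= 1. Proof. by rewrite /g ge_min lexx. Qed.

Let g_bounded x : has_ubound (range (fun k => g k x)).
Proof. by exists 1 => _ [k _ <-]. Qed.

Lemma test_function_ge K k x : (K <= k)%N -> g k x <= test_function K x.
Proof.
by move=> Kk; apply: ub_le_sup; [exists 1 => _ [j _ <-]|exists k].
Qed.

Lemma test_function_ge0 K x : 0 <= test_function K x.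
Proof. exact: le_trans (g0 K x) (test_function_ge x (leqnn K)). Qed.

Lemma test_function_le1 K x : test_function K x <= 1.
Proof. by apply: ge_sup; [exists (g K x); exists K => /=|move=> _ [k _ <-]]. Qed.

Lemma measurable_test_function K : measurable_fun setT (test_function K).
Proof.
apply: measurable_fun_sups => [x _|k]; first exact: g_bounded.
apply: measurable_minr; first exact: measurable_cst.
apply: measurable_funM; first exact: measurable_cst.
apply: measurable_funD.
  apply: (measurableT_comp (@normr_measurable R setT)); apply: measurable_funB => //.
  apply: (measurable_dist_continuous H).
  exact: (smooth_mean_continuous H p1 mu_u u_loc (rad0 k)).
apply: (measurable_dist_continuous H).
exact: (osc_sup_continuous H p1 mu_u (rad0 k) (iosc k)).
Qed.

Let c K k : R := (if (K <= k)%N then w k else 0) * D.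

Let c0 K k : 0 <= c K k.
Proof. by rewrite mulr_ge0//; case: ifP => // _; exact: ltW. Qed.

Lemma test_function_powR_le K x :
  ((test_function K x `^ p)%:E <= \sum_(k <oo) ((c K k)%:E * total (rad k) x))%E.
Proof.
have S0 : (0 <= \sum_(k <oo) ((c K k)%:E * total (rad k) x))%E.
  by apply: nneseries_ge0 => k _ _; rewrite mule_ge0// lee_fin.
have gS k : (K <= k)%N ->
    ((g k x `^ p)%:E <= \sum_(k <oo) ((c K k)%:E * total (rad k) x))%E.
  move=> Kk; apply: le_trans (nneseries_term_le k _); last first.
    by move=> j; rewrite mule_ge0// lee_fin.
  rewrite /c Kk.
  have h := scale_defect_powR_le H p1 mu_u u_loc (rad0 k) (iosc k) x.
  apply: (@le_trans _ _ ((w k)%:E * (defect (rad k) x `^ p)%:E)%E).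
    rewrite -EFinM lee_fin -lamp -powRM ?(ltW (lam0 k))//.
    by apply: ler_powR2r => //; rewrite /g ge_min lexx orbT.
  by rewrite EFinM -muleA lee_wpmul2l// lee_fin ltW.
(* An infinite sum leaves nothing to prove; for a finite one, a p-th root moves the power out of the
   way of the supremum. *)
move: S0 gS; case: (\sum_(k <oo) _)%E => [s s0 gS|_ _|//]; last by rewrite leey.
rewrite lee_fin; apply: powR_inv_le => //; first exact: test_function_ge0.
apply: ge_sup; first by exists (g K x); exists K => /=.
by move=> _ [k /= Kk <-]; apply: le_powR_inv => //; rewrite -lee_fin gS.
Qed.

(** Suprema differ by at most the largest difference of their terms, so it suffices to bound each
    scale k >= K separately by the whole sum. *)
Lemma test_function_diff_le K x y : 0 < dist x y ->
  ((`|test_function K x - test_function K y| `^ p)%:E <=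
    \sum_(k <oo) (c K k)%:E *
      (((Num.min 1 (dist x y / rad k) `^ p)%R)%:E *
        (total (rad k) x + total (rad k) y) +
       ((if rad k / 2 <= dist x y < rad k then `|u x - u y| `^ p else 0)%R)%:E))%E.
Proof.
move=> xy.
pose a k : \bar R := (((Num.min 1 (dist x y / rad k) `^ p)%R)%:E *
  (total (rad k) x + total (rad k) y))%E.
pose b k : \bar R :=
  ((if rad k / 2 <= dist x y < rad k then `|u x - u y| `^ p else 0)%R)%:E.
have a0 k : (0 <= a k)%E by apply: mule_ge0; [rewrite lee_fin powR_ge0|exact: adde_ge0].
have b0 k : (0 <= b k)%E by rewrite /b; case: ifP => // _; rewrite lee_fin powR_ge0.
have ca0 k : (0 <= (c K k)%:E * a k)%E by rewrite mule_ge0// lee_fin.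
have cb0 k : (0 <= (c K k)%:E * b k)%E by rewrite mule_ge0// lee_fin.
have S0 : (0 <= \sum_(k <oo) ((c K k)%:E * (a k + b k)))%E.
  by apply: nneseries_ge0 => k _ _; rewrite mule_ge0 ?adde_ge0// lee_fin.
have gS k : (K <= k)%N -> ((`|g k x - g k y| `^ p)%:E <=
    \sum_(k <oo) ((c K k)%:E * (a k + b k)))%E.
  move=> Kk.
  have h := scale_defect_diff_le H p1 mu_u u_loc (rad0 k) (iosc k) x y.
  set z : \bar R := ((if _ < _ then _ else 0)%R)%:E in h.
  have z0 : (0 <= z)%E by rewrite /z; case: ifP => // _; rewrite lee_fin powR_ge0.
  apply: (@le_trans _ _ ((w k)%:E * (D%:E * (a k + z)))%E).
    apply: (@le_trans _ _ ((w k)%:E *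
        (`|defect (rad k) x - defect (rad k) y| `^ p)%:E)%E); last first.
      by rewrite lee_wpmul2l// lee_fin ltW.
    rewrite -EFinM lee_fin -lamp -powRM ?(ltW (lam0 k))//.
    apply: ler_powR2r => //; apply: le_trans (normr_minr_le _ _) _.
    by rewrite -mulrBr normrM (gtr0_norm (lam0 k)).
  under eq_eseriesr do rewrite ge0_muleDr//.
  rewrite nneseriesD// muleA -EFinM ge0_muleDr//; apply: leeD.
    by apply: le_trans (nneseries_term_le k ca0); rewrite /c Kk.
  rewrite /z; case: ltP => [xyk|_]; last by rewrite mule0 nneseries_ge0.
  (* The pair lies in the shell of some scale [m], and [m >= k] because d(x,y) < r_k. As the weights
     increase, the shell term of index [m] pays for the term left over at scale [k]. *)
  have [m /andP[m1 m2]] : exists m, 2 ^+ m < (dist x y)^-1 <= 2 ^+ m.+1.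
    apply: dyadic_lt; rewrite invf_gt1//; exact: lt_le_trans xyk (rad_le1 k).
  have km : (k <= m)%N.
    have h12 : 1 < 2 :> R by rewrite ltr1n.
    rewrite -ltnS -(ltr_eXn2l h12).
    apply: lt_le_trans m2; rewrite -[ltLHS]invrK ltf_pV2 ?posrE ?invr_gt0 ?exprn_gt0//.
    by rewrite -exprVn.
  apply: le_trans (nneseries_term_le m cb0); rewrite /c /b (leq_trans Kk km) ifT.
    by rewrite lee_wpmul2r ?lee_fin ?powR_ge0// ler_wpM2r// w_mono.
  apply/andP; split.
    rewrite -radiusS /radius exprVn -[leRHS]invrK lef_pV2 ?posrE ?invr_gt0 ?exprn_gt0//.
  by rewrite /radius exprVn -[ltLHS]invrK ltf_pV2 ?posrE ?invr_gt0 ?exprn_gt0.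
move: S0 gS; rewrite -/(a _) -/(b _).
case: (\sum_(k <oo) _)%E => [s s0 gS|_ _|//]; last by rewrite leey.
rewrite lee_fin; apply: powR_inv_le => //.
apply: ler_dist_sups; [exact: g_bounded|exact: g_bounded|].
by move=> k Kk; apply: le_powR_inv => //; rewrite -lee_fin gS.
Qed.

Let tail K : \bar R := (\sum_(k <oo) ((if (K <= k)%N then w k else 0)%:E * e k))%E.

Let tail0 K k : (0 <= (if (K <= k)%N then w k else 0)%:E * e k)%E.
Proof. by rewrite mule_ge0// lee_fin; case: ifP => // _; exact: ltW. Qed.

Let w' K k : 0 <= (if (K <= k)%N then w k else 0 : R).
Proof. by case: ifP => // _; exact: ltW. Qed.

Lemma int_test_function_le K :
  (\int[mu]_x (test_function K x `^ p)%:E <= (D * (1 + A))%:E * tail K)%E.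
Proof.
apply: (@le_trans _ _ (\int[mu]_x \sum_(k <oo) ((c K k)%:E * total (rad k) x))%E).
  apply: ge0_le_integralT => x; first by rewrite lee_fin powR_ge0.
  exact: test_function_powR_le.
rewrite integral_nneseries//; last 2 first.
- by move=> k; exact: measurable_funeM.
- by move=> k x _; rewrite mule_ge0// lee_fin.
rewrite -nneseriesZl; last by move=> k _; exact: tail0.
apply: lee_nneseries => [k _ _|k _].
  by apply: integral_ge0 => x _; rewrite mule_ge0// lee_fin.
rewrite ge0_integralZl//; last by rewrite lee_fin.
apply: (@le_trans _ _ ((c K k)%:E * ((1 + A)%:E * e k))%E).
  rewrite lee_wpmul2l ?lee_fin//; apply: (le_trans (itotal k)).
  by rewrite lee_wpmul2l ?lee_fin ?addr_ge0.
rewrite /c !muleA -!EFinM; set W := (if _ then _ else _).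
by have -> : W * D * (1 + A) = D * (1 + A) * W by ring.
Qed.

(** The first factor and [A ^+ 3], 2^q come from [energy_le], [D] from the defect, and
    [2 + A = (1 + A) + 1] from the integrals of [total] and of the oscillation. *)
Let E : R := ((1 - scale_ratio p q)^-1 * (2 * (1 + A)) + 1) *
  (D * (A ^+ 3 * 2 `^ q)) * (2 + A).

Let E0 : 0 <= E.
Proof.
have /andP[s0 s1] := scale_ratio01 q0 qp.
apply: mulr_ge0; last by rewrite addr_ge0.
apply: mulr_ge0; last by rewrite !mulr_ge0 ?exprn_ge0 ?powR_ge0.
apply: addr_ge0 => //; apply: mulr_ge0; last by rewrite mulr_ge0// addr_ge0.
by rewrite invr_ge0 subr_ge0 ltW.
Qed.

Lemma energy_test_function_le K : (energy (test_function K) <= E%:E * tail K)%E.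
Proof.
have /andP[s0 s1] := scale_ratio01 q0 qp.
have F0 : 0 <= (1 - scale_ratio p q)^-1 * (2 * (1 + A)) + 1.
  apply: addr_ge0 => //; apply: mulr_ge0; last by rewrite mulr_ge0// addr_ge0.
  by rewrite invr_ge0 subr_ge0 ltW.
apply: (le_trans (energy_le H q0 qp mu_u (c0 K) total0 mtotal
  (test_function_diff_le K))).
rewrite (_ : E = ((1 - scale_ratio p q)^-1 * (2 * (1 + A)) + 1) *
  (D * (A ^+ 3 * 2 `^ q) * (2 + A))); last by rewrite /E -[LHS]mulrA.
rewrite [X in (_ <= X * _)%E]EFinM -[leRHS]muleA; apply: lee_wpmul2l.
  by rewrite lee_fin.
rewrite -nneseriesZl; last by move=> k _; exact: tail0.
have G0 k : 0 <= c K k * (A ^+ 3 * 2 `^ q * (rad k `^ q)^-1).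
  by rewrite !mulr_ge0 ?exprn_ge0 ?invr_ge0 ?powR_ge0.
have it0 k : (0 <= \int[mu]_x total (rad k) x)%E by apply: integral_ge0.
apply: lee_nneseries => [k _ _|k _].
  by apply: mule_ge0; [rewrite lee_fin; exact: G0|exact: adde_ge0].
apply: (@le_trans _ _ ((c K k * (A ^+ 3 * 2 `^ q * (rad k `^ q)^-1))%:E *
    ((2 + A)%:E * \int[mu]_x osc (2 * rad k)%R x))%E).
  apply: lee_wpmul2l; first by rewrite lee_fin; exact: G0.
  have -> : 2 + A = (1 + A) + 1 by ring.
  rewrite EFinD ge0_muleDl ?lee_fin ?addr_ge0// mul1e leeD2r//.
rewrite /e /c !muleA -!EFinM; set W := (if _ then _ else _).
rewrite lee_wpmul2r// lee_fin le_eqVlt; apply/orP; left; apply/eqP; ring.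
Qed.

Lemma test_function_small eps : 0 < eps -> exists K,
  (\int[mu]_x (test_function K x `^ p)%:E <= eps%:E)%E /\
  (energy (test_function K) <= eps%:E)%E.
Proof.
(* A common bound for both constants; the summand 1 makes it positive, so that [eps] can be divided
   by it. *)
move=> eps0; pose M := D * (1 + A) + E + 1.
have M1 : D * (1 + A) <= M by rewrite /M -addrA lerDl addr_ge0.
have M2 : E <= M by rewrite /M addrAC lerDr addr_ge0// mulr_ge0// addr_ge0.
have M0 : 0 < M by rewrite ltr_wpDl// addr_ge0// mulr_ge0// addr_ge0.
have [K hK] := w_sum (divr_gt0 eps0 M0).
have tK0 : (0 <= tail K)%E by apply: nneseries_ge0 => k _ _; exact: tail0.
have MK : (M%:E * tail K <= eps%:E)%E.
  apply: (@le_trans _ _ (M%:E * (eps / M)%:E)%E).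
    by rewrite lee_wpmul2l// lee_fin ltW.
  by rewrite -EFinM mulrC divfK// gt_eqF.
exists K; split.
  by apply: le_trans (int_test_function_le K) _; apply: le_trans MK; rewrite lee_wpmul2r.
by apply: le_trans (energy_test_function_le K) _; apply: le_trans MK; rewrite lee_wpmul2r.
Qed.

(** Only continuous functions appear, which makes the set open: the possibly discontinuous |u_k - u|
    is replaced by |u_k - u_l|. The threshold 2 accounts for the passage through [u]. *)
Definition bad_set K : set T := [set x |
  (exists k l, [/\ (K <= k)%N, (k <= l)%N &
    2 < lam k * `|smooth (rad k) x - smooth (rad l) x|]) \/
  (exists2 k, (K <= k)%N & 1 < lam k * osc_sup mu dist p u (rad k) x)].

Lemma bad_set_open K : dist_open dist (bad_set K).
Proof.
move=> x [[k [l [Kk kl h]]]|[k Kk h]].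
  have cS j : dist_continuous dist (smooth (rad j)).
    exact: (smooth_mean_continuous H p1 mu_u u_loc (rad0 j)).
  have h' : 2 / lam k < `|smooth (rad k) x - smooth (rad l) x|.
    by rewrite (ltr_pdivrMr _ _ (lam0 k)) mulrC.
  have [e1 e10 he] := dist_continuous_open_norm (dist_continuousB (cS k) (cS l)) h'.
  exists e1; first exact: e10.
  move=> y /he /= hy; left; exists k, l; split; [exact: Kk|exact: kl|].
  by rewrite mulrC -(ltr_pdivrMr _ _ (lam0 k)).
have cS : dist_continuous dist (osc_sup mu dist p u (rad k)).
  exact: (osc_sup_continuous H p1 mu_u (rad0 k) (iosc k)).
have h' : (lam k)^-1 < osc_sup mu dist p u (rad k) x.
  by rewrite -[ltLHS]mul1r (ltr_pdivrMr _ _ (lam0 k)) mulrC.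
have [e1 e10 he] := dist_continuous_open cS h'.
exists e1; first exact: e10.
move=> y /he /= hy; right; exists k; first exact: Kk.
by rewrite mulrC -(ltr_pdivrMr _ _ (lam0 k)) mul1r.
Qed.

Let smooth_defect k x : `|smooth (rad k) x - u x| <= defect (rad k) x.
Proof. by rewrite lerDl; exact: (osc_sup_ge0 H p1 mu_u (rad0 k) (iosc k)). Qed.

(** If [lam k] times |u_k - u_l| exceeds 2, then [lam k] times |u_k - u| or, since [lam k <= lam l],
    [lam l] times |u_l - u| exceeds 1. *)
Lemma test_function_bad_set K x : bad_set K x -> 1 <= test_function K x.
Proof.
have key k : (K <= k)%N -> 1 < lam k * defect (rad k) x -> 1 <= test_function K x.
  move=> Kk h; apply: le_trans (test_function_ge x Kk).
  by rewrite /g le_min lexx ltW.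
move=> [[k [l [Kk kl h]]]|[k Kk h]]; last first.
  apply: (key k Kk); apply: (lt_le_trans h); rewrite ler_pM2l// lerDr.
  exact: normr_ge0.
have [h1|h1] := ltP 1 (lam k * defect (rad k) x); first exact: key h1.
apply: (key l (leq_trans Kk kl)).
have h2 : lam k * `|smooth (rad k) x - smooth (rad l) x| <=
    lam k * `|smooth (rad k) x - u x| + lam l * `|smooth (rad l) x - u x|.
  apply: (@le_trans _ _ (lam k * (`|smooth (rad k) x - u x| + `|smooth (rad l) x - u x|))).
    rewrite ler_pM2l//; apply: le_trans (ler_distD (u x) _ _) _.
    by rewrite [`|u x - _|]distrC.
  by rewrite mulrDr lerD2l ler_wpM2r// lam_mono.
have h3 : lam k * `|smooth (rad k) x - u x| <= lam k * defect (rad k) x.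
  by rewrite (ler_pM2l (lam0 _)); exact: smooth_defect.
have h4 : lam l * `|smooth (rad l) x - u x| <= lam l * defect (rad l) x.
  by rewrite (ler_pM2l (lam0 _)); exact: smooth_defect.
move: h h1 h2 h3 h4; move: (lam k * `|_|) (lam k * `|_|) (lam l * `|_|)
  (lam k * defect _ _) (lam l * defect _ _) => ? ? ? ? ?; lra.
Qed.

Let lam_infty M : exists K, forall k, (K <= k)%N -> M <= lam k.
Proof.
have [K hK] := w_infty (Num.max M 0 `^ p); exists K => k /hK h.
have m0 : 0 <= Num.max M 0 by rewrite le_max lexx orbT.
apply: (@le_trans _ _ (Num.max M 0)); first by rewrite le_max lexx.
by apply: le_powR_inv => //; exact: ltW.
Qed.

Let off_bad K k l x : ~ bad_set K x -> (K <= k)%N -> (k <= l)%N ->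
  `|smooth (rad k) x - smooth (rad l) x| <= 2 / lam k.
Proof.
move=> nbad Kk kl; rewrite leNgt; apply/negP => h; apply: nbad; left.
exists k, l; split; [exact: Kk|exact: kl|].
by rewrite mulrC -(ltr_pdivrMr _ _ (lam0 k)).
Qed.

Let off_bad_osc K k x : ~ bad_set K x -> (K <= k)%N ->
  osc_sup mu dist p u (rad k) x <= (lam k)^-1.
Proof.
move=> nbad Kk; rewrite leNgt; apply/negP => h; apply: nbad; right.
exists k; first exact: Kk.
by rewrite mulrC -(ltr_pdivrMr _ _ (lam0 k)) mul1r.
Qed.

Let two_lam_small eps : 0 < eps -> exists K, forall k, (K <= k)%N -> 2 / lam k < eps.
Proof.
move=> eps0; have [K hK] := lam_infty (2 / (eps / 2)); exists K => k /hK.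
rewrite ler_pdivrMr; last by lra.
by rewrite ltr_pdivrMr// mulrC => h; have := lam0 k; nra.
Qed.

Lemma representative_cvg K x : ~ bad_set K x ->
  smooth (rad k) x @[k --> \oo] --> representative x.
Proof.
move=> nbad; apply/cauchy_cvgP; apply: cauchy_exP => eps eps0.
have [K' hK'] := two_lam_small eps0.
exists (smooth (rad (maxn K K')) x); exists (maxn K K') => // l /= hl.
rewrite -ball_normE/=; apply: le_lt_trans (hK' _ (leq_maxr K K')).
by apply: off_bad nbad _ hl; exact: leq_maxl.
Qed.

Lemma smooth_representative_le K k x : ~ bad_set K x -> (K <= k)%N ->
  `|smooth (rad k) x - representative x| <= 2 / lam k.
Proof.
move=> nbad Kk; apply/ler_addgt0Pr => eps eps0.
have /cvgrPdist_le /(_ _ eps0) [N _ hN] := representative_cvg nbad.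
have h2 := hN (maxn N k) (leq_maxl N k).
have h1 := off_bad nbad Kk (leq_maxr N k).
apply: le_trans (ler_distD (smooth (rad (maxn N k)) x) _ _) _.
by apply: lerD; [exact: h1|rewrite distrC; exact: h2].
Qed.

Lemma representative_continuous K x : ~ bad_set K x -> forall eps, 0 < eps ->
  exists2 dl, 0 < dl & forall y, ~ bad_set K y -> dist x y < dl ->
    `|representative x - representative y| < eps.
Proof.
move=> nx eps eps0; have eps30 : 0 < eps / 3 by lra.
have [K' hK'] := two_lam_small eps30.
pose k := maxn K K'.
have [dl dl0 h] := smooth_mean_continuous H p1 mu_u u_loc (rad0 k) x eps30.
exists dl => // y ny /h {}h.
have h1 := smooth_representative_le nx (leq_maxl K K').
have h2 := smooth_representative_le ny (leq_maxl K K').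
have h3 := hK' k (leq_maxr K K').
rewrite -/k in h1 h2; move: h h1 h2 h3.
move: (smooth _ x) (smooth _ y) (representative x) (representative y) (2 / lam k).
move=> sx sy vx vy t h h1 h2 h3.
have -> : vx - vy = (sx - sy) - (sx - vx) + (sy - vy) by ring.
apply: le_lt_trans (ler_normD _ _) _.
by have := ler_normB (sx - sy) (sx - vx); lra.
Qed.

(** The number u_k(x) is inserted between: its distance to the limit is at most [2 / lam k], and the
    oscillation of [u] around it is bounded by [osc_sup]. Inside the integral [u] is kept, as the
    oscillation estimates are about [u]. *)
Lemma mean_diff_representative_le K k x : ~ bad_set K x -> (K <= k)%N ->
  (mean (rad k) (fun z => (`|u z - representative x| `^ p)%:E) x <=
    (2 `^ p * ((4 * A) `^ p * A ^+ 2 + 2 `^ p) / w k)%:E)%E.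
Proof.
move=> nx Kk; set v := representative x; set s := smooth (rad k) x.
have mk : measurable_fun setT (fun y => (ker (rad k) x y)%:E).
  by apply/measurable_EFinP; exact: (measurable_ker_r H).
have md a : measurable_fun setT (fun z => (`|u z - a| `^ p)%:E).
  by apply/measurable_EFinP; exact: measurable_diff.
have sv : `|s - v| `^ p <= 2 `^ p / w k.
  rewrite -lamp -inv_powR ?(ltW (lam0 k))// -powRM ?invr_ge0 ?(ltW (lam0 k))//.
  by apply: ler_powR2r => //; exact: smooth_representative_le nx Kk.
have ms : (mean (rad k) (fun z => (`|u z - s| `^ p)%:E) x <=
    ((4 * A) `^ p * A ^+ 2 / w k)%:E)%E.
  apply: le_trans (mean_diff_smooth_le H p1 mu_u u_loc (rad0 k) x) _.
  have mf := mean_osc_fin H mu_u (iosc k) x (rad0 k).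
  rewrite mf -EFinM lee_fin ler_wpM2l ?mulr_ge0 ?powR_ge0 ?exprn_ge0//.
  rewrite -lamp -inv_powR ?(ltW (lam0 k))//.
  have f0 : 0 <= fine (mean (rad k) (osc (2 * rad k)) x).
    by rewrite fine_ge0// mean_ge0// => y; exact: osc_ge0.
  rewrite -[leLHS](powR_invK f0 p0); apply: ler_powR2r => //; first exact: powR_ge0.
  apply: le_trans (off_bad_osc nx Kk).
  exact: (osc_sup_ge H p1 mu_u (rad0 k) (iosc k)).
apply: (@le_trans _ _ (\int[mu]_z ((2 `^ p)%:E *
    ((ker (rad k) x z)%:E * (`|u z - s| `^ p)%:E) +
    (2 `^ p * `|s - v| `^ p)%:E * (ker (rad k) x z)%:E))%E).
  apply: ge0_le_integralT => z; first by rewrite mule_ge0// lee_fin ?ker_ge0 ?powR_ge0.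
  rewrite -!EFinM -EFinD lee_fin.
  have -> : 2 `^ p * (ker (rad k) x z * `|u z - s| `^ p) +
    2 `^ p * `|s - v| `^ p * ker (rad k) x z =
    ker (rad k) x z * (2 `^ p * (`|u z - s| `^ p + `|s - v| `^ p)) by ring.
  rewrite ler_wpM2l ?ker_ge0//; apply: le_trans (powRD_le _ _ _) => //.
  apply: ler_powR2r => //.
  have -> : u z - v = (u z - s) + (s - v) by ring.
  exact: ler_normD.
have k0 z : (0 <= (ker (rad k) x z)%:E)%E by rewrite lee_fin ker_ge0.
have d0 a z : (0 <= (`|u z - a| `^ p)%:E)%E by rewrite lee_fin powR_ge0.
have t0 : (0 <= (2 `^ p)%:E :> \bar R)%E by rewrite lee_fin powR_ge0.
have t1 : (0 <= (2 `^ p * `|s - v| `^ p)%:E)%E by rewrite lee_fin mulr_ge0 ?powR_ge0.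
have mkd : measurable_fun setT (fun z => (ker (rad k) x z)%:E * (`|u z - s| `^ p)%:E)%E.
  exact: emeasurable_funM.
rewrite ge0_integralD//; last 4 first.
- by move=> z _; apply: mule_ge0 => //; exact: mule_ge0.
- exact: measurable_funeM.
- by move=> z _; exact: mule_ge0.
- exact: measurable_funeM.
rewrite ge0_integralZl//; last by move=> z _; exact: mule_ge0.
rewrite ge0_integralZl// (int_kerr H)// mule1.
apply: (@le_trans _ _ ((2 `^ p)%:E * ((4 * A) `^ p * A ^+ 2 / w k)%:E +
    (2 `^ p * (2 `^ p / w k))%:E)%E).
  apply: leeD; first exact: lee_wpmul2l.
  by rewrite lee_fin ler_wpM2l ?powR_ge0.
rewrite -EFinM -EFinD lee_fin le_eqVlt; apply/orP; left; apply/eqP; ring.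
Qed.

Lemma representative_lebesgue K x : ~ bad_set K x -> forall eps, 0 < eps ->
  exists2 dl, 0 < dl & forall r, 0 < r < dl -> ((mu (B x r))^-1 *
    \int[mu]_(y in B x r) (`|representative y - representative x| `^ p)%:E <=
    eps%:E)%E.
Proof.
move=> nx eps eps0.
pose C := 2 `^ p * ((4 * A) `^ p * A ^+ 2 + 2 `^ p).
have C0 : 0 <= C by rewrite mulr_ge0 ?powR_ge0// addr_ge0 ?mulr_ge0 ?powR_ge0 ?exprn_ge0.
have [K' hK'] := w_infty (A * C / eps).
pose k0 := maxn K K'; exists (rad k0) => // r /andP[r0 rk0].
(* The radius [r] is compared with the dyadic one satisfying r < r_k <= 2r, at the cost of one
   factor [A]; this factor is included in the choice of [K']. *)
have [k /andP[k1 k2]] : exists k, 2 ^+ k < r^-1 <= 2 ^+ k.+1.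
  by apply: dyadic_lt; rewrite invf_gt1//; exact: lt_le_trans rk0 (rad_le1 k0).
have h12 : 1 < 2 :> R by rewrite ltr1n.
have kk0 : (k0 <= k)%N.
  rewrite -ltnS -(ltr_eXn2l h12).
  apply: lt_le_trans k2; rewrite -[ltLHS]invrK ltf_pV2 ?posrE ?invr_gt0 ?exprn_gt0//.
  by rewrite -exprVn.
have rk : r < rad k.
  by rewrite /radius exprVn -[ltLHS]invrK ltf_pV2 ?posrE ?invr_gt0 ?exprn_gt0.
have kr : rad k <= 2 * r.
  have : rad k / 2 <= r; last by lra.
  by rewrite -radiusS /radius exprVn -[leRHS]invrK lef_pV2 ?posrE ?invr_gt0 ?exprn_gt0.
have Kk : (K <= k)%N by exact: leq_trans (leq_maxl _ _) kk0.
have K'k : (K' <= k)%N by exact: leq_trans (leq_maxr _ _) kk0.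
set v := representative x.
have v0 := vol_gt0 H x r0; have v0' := vol_gt0 H x (rad0 k).
have vv : vol x (rad k) <= A * vol x r.
  rewrite -[A]expr1; apply: (vol_le_exp H) => //.
  by rewrite (dist_xx H) add0r expr1.
have md a : measurable_fun setT (fun z => (`|u z - a| `^ p)%:E).
  by apply/measurable_EFinP; exact: measurable_diff.
have mk : measurable_fun setT (fun y => (ker (rad k) x y)%:E).
  by apply/measurable_EFinP; exact: (measurable_ker_r H).
have kd0 z : (0 <= (ker (rad k) x z)%:E * (`|u z - v| `^ p)%:E)%E.
  by rewrite mule_ge0// lee_fin ?ker_ge0 ?powR_ge0.
have step : (\int[mu]_(y in B x r) (`|representative y - v| `^ p)%:E <=
    (vol x (rad k))%:E * mean (rad k) (fun z => (`|u z - v| `^ p)%:E) x)%E.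
  rewrite -ge0_integralZl//; last 2 first.
  - exact: emeasurable_funM.
  - by rewrite lee_fin ltW.
  rewrite [leLHS]integral_mkcond; apply: ae_le_integralT.
  - by move=> y; apply: erestrict_ge0 => z _; rewrite lee_fin powR_ge0.
  - by move=> y; rewrite mule_ge0// lee_fin ltW.
  - by apply: measurable_funeM; exact: emeasurable_funM.
  apply: filterS ae_representative => y uv; rewrite patchE; case: ifPn => yB.
    rewrite inE /mball/= in yB; rewrite -uv.
    rewrite /ball_kernel (lt_trans yB rk) muleA -EFinM mulfV ?mul1r//.
    by rewrite gt_eqF.
  (* Outside the ball the restricted integrand takes the default value [point], which is 0 in the
     extended reals. *)
  by rewrite (_ : point = 0%E)// mule_ge0// lee_fin ltW.
rewrite (mu_mball H)// inver gt_eqF//.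
apply: (@le_trans _ _ ((vol x r)^-1%:E * ((vol x (rad k))%:E * (C / w k)%:E))%E).
  apply: lee_wpmul2l; first by rewrite lee_fin invr_ge0 ltW.
  apply: (le_trans step); apply: lee_wpmul2l; first by rewrite lee_fin ltW.
  exact: mean_diff_representative_le nx Kk.
rewrite -!EFinM lee_fin.
apply: (@le_trans _ _ (A * (C / w k))).
  rewrite mulrA ler_wpM2r ?divr_ge0 ?(ltW (w_gt0 k))//.
  by rewrite ler_pdivrMl// mulrC.
have h := hK' k K'k; rewrite ler_pdivrMr// in h.
by rewrite mulrA ler_pdivrMr// [leRHS]mulrC.
Qed.

End weights.


(** [F K] is the competitor for the capacity of [U K], and the third clause makes that capacity
    small. The last two clauses are pointwise off a single [U K], the form needed for both
    quasicontinuity and Lebesgue points. *)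
Theorem besov_representative : exists (v : T -> R) (U : nat -> set T) (F : nat -> T -> R),
  [/\ {ae mu, forall x, u x = v x},
    forall K, [/\ dist_open dist (U K), measurable_fun setT (F K),
      forall x, 0 <= F K x <= 1 & forall x, U K x -> 1 <= F K x],
    forall eps, 0 < eps -> exists K,
      (\int[mu]_x (F K x `^ p)%:E <= eps%:E)%E /\ (energy (F K) <= eps%:E)%E,
    forall K x, ~ U K x -> forall eps, 0 < eps ->
      exists2 dl, 0 < dl & forall y, ~ U K y -> dist x y < dl -> `|v x - v y| < eps &
    forall K x, ~ U K x -> forall eps, 0 < eps ->
      exists2 dl, 0 < dl & forall r, 0 < r < dl -> ((mu (B x r))^-1 *
        \int[mu]_(y in B x r) (`|v y - v x| `^ p)%:E <= eps%:E)%E].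
Proof.
have [w [w_gt0 w_mono w_infty w_sum]] := summable_weights e0 e_sum.
exists representative, (bad_set w), (test_function w); split.
- exact: ae_representative.
- move=> K; split.
  + exact: bad_set_open.
  + exact: measurable_test_function.
  + by move=> x; rewrite test_function_ge0// test_function_le1.
  + by move=> x; exact: test_function_bad_set.
- exact: test_function_small.
- exact: representative_continuous.
- exact: representative_lebesgue.
Qed.

End multiscale.

(** * Besov capacity *)

Definition sigma_finite_pack d (T : measurableType d) (R : realType)
    (m : {measure set T -> \bar R}) (sf : sigma_finite setT m) :
    {sigma_finite_measure set T -> \bar R} :=
  HB.pack_for (SigmaFiniteMeasure.type T R) (Measure.sort m)
    (@isSFinite.Build d T R m (sfinite_measure_sigma_finite sf))
    (@isSigmaFinite.Build d T R m sf).

Section transfer.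
Context (R : realType) (Z : completeMetricType R).
Variables (nu : {outer_measure set Z -> \bar R}) (p theta : R).
Hypotheses (nu_mm : metric_measure nu) (p1 : 1 <= p).

Local Notation T := (caratheodory_type nu).
Local Notation dist := (@mdist R Z : T -> T -> R).

Lemma ball_mballE (x : Z) r : ball x r = mball (@mdist R Z) x r.
Proof. by rewrite ballEmdist. Qed.

Lemma dist_openP (U : set Z) : dist_open (@mdist R Z) U <-> open U.
Proof.
rewrite openE; split => h x /h.
  move=> [e e0 xe]; rewrite /interior -nbhs_ballE; exists e => //=.
  by rewrite ball_mballE.
rewrite /interior -nbhs_ballE => -[e /= e0]; rewrite ball_mballE => xe.
by exists e.
Qed.

Lemma sigma_finite_cara : sigma_finite [set: T] (nu : set T -> \bar R).
Proof.
exists (fun n => ball (point : Z) n.+1%:R).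
  apply/seteqP; split => // x _.
  exists (Num.bound (mdist (point : Z) x)) => //.
  rewrite ball_mballE /mball/=; apply: lt_trans (archi_boundP (mdist_ge0 _ _)) _.
  by rewrite ltr_nat.
move=> n; split; last by have /andP[] := nu_mm.2 point n.+1%:R (ltr0Sn _ _).
apply: nu_mm.1.1; apply/dist_openP => y; rewrite ball_mballE => py.
exists (n.+1%:R - mdist (point : Z) y); first by rewrite subr_gt0.
move=> z; rewrite /mball/= ltrBrDl; apply: le_lt_trans.
exact: metric_triangle.
Qed.

Definition cara_sigma_finite : {sigma_finite_measure set T -> \bar R} :=
  @sigma_finite_pack _ T R (nu : set T -> \bar R) sigma_finite_cara.

Local Notation mu := cara_sigma_finite.

Lemma doubling_space_cara C : (forall (z : Z) r, 0 < r ->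
    (nu (ball z (2 * r)) <= C%:E * nu (ball z r))%E) ->
  doubling_space mu dist C.
Proof.
move=> nuC; split.
- exact: mdistxx.
- exact: mdist_positivity.
- exact: metric_sym.
- by move=> y x z; exact: metric_triangle.
- by move=> U /dist_openP oU; exact: nu_mm.1.1.
- by move=> x r r0; rewrite -ball_mballE; exact: nu_mm.2.
- by move=> x r r0; rewrite -!ball_mballE; exact: nuC.
Qed.

Lemma besov_normE u : besov_norm nu theta p u = (energy mu dist p (p * theta) u `^ p^-1)%E.
Proof.
have ballE : @ball R Z = mball (@mdist R Z).
  by apply/funext => x; apply/funext => r; exact: ball_mballE.
by rewrite /besov_norm ballE.
Qed.

Let p0 : 0 < p. Proof. exact: lt_le_trans ltr01 p1. Qed.
Let pV0 : 0 < p^-1. Proof. by rewrite invr_gt0. Qed.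

(** Both parts of the norm are at most eps^(1/p), and the p-th power of twice this number gives the
    constant. Keeping [G] apart from [U] lets the estimate serve the open sets as well as a set
    contained in all of them. *)
Lemma besov_capacity_le (G U : set Z) (F : Z -> R) eps :
  open U -> G `<=` U -> measurable_fun [set: T] (F : T -> R) ->
  (forall x, 0 <= F x) -> (forall x, U x -> 1 <= F x) -> 0 <= eps ->
  (\int[mu]_x (F x `^ p)%:E <= eps%:E)%E ->
  (energy mu dist p (p * theta) F <= eps%:E)%E ->
  (besov_capacity nu theta p G <= (2 `^ p * eps)%:E)%E.
Proof.
move=> oU GU mF F0 FU eps0 iF eF.
have iF0 : (0 <= \int[mu]_x (F x `^ p)%:E)%E.
  by apply: integral_ge0 => x _; rewrite lee_fin powR_ge0.
have eF0 : (0 <= energy mu dist p (p * theta) F)%E.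
  apply: integral_ge0 => y _; apply: integral_ge0 => x _.
  by rewrite mule_ge0 ?inve_ge0// lee_fin divr_ge0// powR_ge0.
have powV_le (x : \bar R) : (0 <= x)%E -> (x <= eps%:E)%E -> (x `^ p^-1 <= (eps `^ p^-1)%:E)%E.
  move=> x0 xe; rewrite -poweR_EFin; apply: gt0_ler_poweR => //.
  - by rewrite ltW.
  - by rewrite in_itv/= x0 leey.
  - by rewrite in_itv/= lee_fin eps0 leey.
have Lp_le : (Lp_norm nu p F <= (eps `^ p^-1)%:E)%E.
  rewrite /Lp_norm unlock; apply: powV_le.
    by apply: integral_ge0 => x _; exact: poweR_ge0.
  apply: le_trans iF; rewrite le_eqVlt; apply/orP; left; apply/eqP.
  by apply: eq_integral => x _ /=; rewrite ger0_norm.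
have B_le : (besov_norm nu theta p F <= (eps `^ p^-1)%:E)%E.
  by rewrite besov_normE; exact: powV_le.
have check : besov_check nu theta p F.
  split; first by split => //; apply: le_lt_trans Lp_le _; rewrite ltry.
  split; last by apply: le_lt_trans B_le _; rewrite ltry.
  split => // z r r0; apply: (@le_lt_trans _ _ eps%:E); last by rewrite ltry.
  apply: le_trans iF; rewrite integral_mkcond; apply: ge0_le_integralT => x.
    by apply: erestrict_ge0 => y _; rewrite lee_fin powR_ge0.
  rewrite patchE; case: ifPn => _; first by rewrite ger0_norm.
  by rewrite (_ : point = 0%E)// lee_fin powR_ge0.
apply: (@le_trans _ _ (besov_check_norm nu theta p F `^ p)%E).
  apply: ereal_inf_lbound; exists F => //; split => //; exists U.
    by move=> x /GU; move: oU; rewrite openE; apply.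
  by apply: nearW => x; exact: FU.
have N0 : (0 <= besov_check_norm nu theta p F)%E.
  by rewrite adde_ge0 ?Lnorm_ge0// besov_normE poweR_ge0.
have N_le : (besov_check_norm nu theta p F <= (2 * eps `^ p^-1)%:E)%E.
  by rewrite mulr_natl mulr2n EFinD; exact: leeD.
apply: (@le_trans _ _ ((2 * eps `^ p^-1)%:E `^ p)%E).
  apply: gt0_ler_poweR => //; first exact: ltW.
  - by rewrite in_itv/= N0 leey.
  - by rewrite in_itv/= lee_fin mulr_ge0 ?powR_ge0// leey.
by rewrite poweR_EFin lee_fin powRM ?powR_ge0// powR_invK.
Qed.

Lemma besov_capacity_ge0 G : (0 <= besov_capacity nu theta p G)%E.
Proof. by apply: le_ereal_inf_tmp => _ [u _ <-]; exact: poweR_ge0. Qed.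

End transfer.

Theorem corollary1p2 (R : realType) (Z : completeMetricType R)
    (nu : {outer_measure set Z -> \bar R}) (p theta : R)
    (nu_mm : metric_measure nu) (nu_doubling : doubling nu)
    (p_ge1 : 1 <= p) (theta_gt0 : 0 < theta) (theta_lt1 : theta < 1) :
  forall u : Z -> R, besov_tilde nu theta p u ->
  exists v : Z -> R,
    [/\ ae_eq_fun nu u v,
        quasicontinuous nu theta p v &
        quasieverywhere nu theta p (Lp_lebesgue_point nu p v)].
Proof.
move=> u [[mu_u u_loc] u_norm]; have [C nuC] := nu_doubling.
have p0 : 0 < p by lra.
have H := doubling_space_cara nu_mm nuC.
have q0 : 0 < p * theta by rewrite mulr_gt0.
have qp : p * theta < p by rewrite gtr_pMr.
have u_loc' : forall (x : Z) r, 0 < r ->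
  (\int[cara_sigma_finite nu_mm]_(y in mball (@mdist R Z) x r) (`|u y| `^ p)%:E < +oo)%E.
  by move=> x r r0; rewrite -ball_mballE; exact: u_loc.
have u_energy : (energy (cara_sigma_finite nu_mm) (@mdist R Z) p (p * theta) u < +oo)%E.
  move: u_norm; rewrite (besov_normE _ _ nu_mm); apply: lty_poweRy.
  by rewrite invr_eq0 gt_eqF.
have [v [U [F [uv UF small cont leb]]]] :=
  besov_representative H p_ge1 q0 qp mu_u u_loc' u_energy.
have cap_small eps (G : set Z) : 0 < eps -> (forall K, G `<=` U K) ->
    (besov_capacity nu theta p G <= eps%:E)%E.
  move=> eps0 GU; have two0 : 0 < 2 `^ p :> R by rewrite powR_gt0.
  have [K [iF eF]] := small _ (divr_gt0 eps0 two0).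
  have [/dist_openP oU mF F01 FU] := UF K.
  have := @besov_capacity_le R Z nu p theta nu_mm p_ge1 G (U K) (F K) (eps / 2 `^ p)
    oU (GU K) mF (fun x => proj1 (andP (F01 x))) FU (ltW (divr_gt0 eps0 two0)) iF eF.
  by rewrite mulrC divfK// gt_eqF.
exists v; split.
- exact: uv.
- move=> eta eta0; have two0 : 0 < 2 `^ p :> R by rewrite powR_gt0.
  (* Halving [eta] turns the large inequality for the capacity into the strict one required. *)
  have eps0 : 0 < eta / 2 / 2 `^ p by rewrite !divr_gt0.
  have [K [iF eF]] := small _ eps0.
  have [/dist_openP oU mF F01 FU] := UF K.
  exists (U K); split => //.
    have := @besov_capacity_le R Z nu p theta nu_mm p_ge1 (U K) (U K) (F K) _
      oU (@subset_refl _ _) mF (fun x => proj1 (andP (F01 x))) FU (ltW eps0) iF eF.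
    move/le_lt_trans; apply; rewrite lte_fin mulrC divfK ?gt_eqF//; lra.
  apply/subspace_continuousP => x xU; apply/cvgrPdist_lt => eps eps1.
  have [dl dl0 hdl] := cont K x xU eps eps1.
  rewrite near_withinE; apply/nbhs_ballP; exists dl => //= y; rewrite ball_mballE => xy yU.
  exact: hdl.
(* Every point off some [U K] is a Lebesgue point, so the exceptional set lies in all the [U K] and
   its capacity is below every positive number. *)
- apply/eqP; rewrite eq_le besov_capacity_ge0 andbT; apply/lee_addgt0Pr => eps eps0.
  rewrite add0e; apply: cap_small => // K x; apply: contra_notP => xU.
  have I0 r : (0 <= (nu (ball x r))^-1 * \int[cara_measure nu]_(y in ball x r)
      (`|v y - v x| `^ p)%:E)%E.
    rewrite mule_ge0 ?inve_ge0//; apply: integral_ge0 => y _.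
    by rewrite lee_fin powR_ge0.
  have Ile eta : 0 < eta -> \forall r \near (0:R)^'+,
      ((nu (ball x r))^-1 * \int[cara_measure nu]_(y in ball x r)
      (`|v y - v x| `^ p)%:E <= eta%:E)%E.
    move=> eta0; have [dl dl0 hdl] := leb K x xU eta eta0.
    near=> r; have := hdl r; rewrite ball_mballE; apply; apply/andP; split.
      by near: r; exact: nbhs_right_gt.
    by near: r; exact: nbhs_right_lt.
  apply/fine_cvgP; split.
    near=> r; rewrite ge0_fin_numE//; apply: (@le_lt_trans _ _ 1%:E); last by rewrite ltry.
    by near: r; exact: Ile.
  apply/cvgrPdist_le => eta eta0; near=> r.
  rewrite sub0r normrN/= ger0_norm ?fine_ge0// -lee_fin fineK.
    by near: r; exact: Ile.
  rewrite ge0_fin_numE//; apply: (@le_lt_trans _ _ eta%:E); last by rewrite ltry.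
  by near: r; exact: Ile.
Unshelve. all: by end_near.
Qed.
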